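(* Let $T,V,\alpha,\Omega,G$ satisfy the Standing Assumption (G), let $\mathcal O\subseteq\mathbb{C}$ be open and let $(\varphi_\kappa)_{\kappa\in\mathcal O}$ be holomorphic functions $\varphi_\kappa:\Omega\to\mathbb{C}$ satisfying $|\varphi_\kappa(z)|\le A(\kappa)e^{B(\kappa)|z|}$ for $z\in\Omega$, with $A(\kappa),B(\kappa)\ge0$ depending continuously on $\kappa$. If for every $z\in\Omega$ the map $\mathcal O\ni\kappa\mapsto\varphi_\kappa(z)$ is holomorphic, then for every fixed $t\in(0,T)$ and $x\in\mathbb{R}$ the map $\mathcal O\ni\kappa\mapsto\Psi(t,x;\varphi_\kappa)$ is holomorphic.
   Context: Double sector: $S_\alpha:=\{0\}\cup\{z\ne0:\mathrm{Arg}(z)\in[0,\alpha]\cup[\pi,\pi+\alpha]\}$, $\mathrm{Arg}\in[0,2\pi)$. $\mathrm{AC}_{1,2}((0,T)\times\mathbb{R})$: functions $\Psi$ with $\Psi(\cdot,x)$ absolutely continuous on $(0,T)$ for all $x$ and $\Psi(t,\cdot),\partial_x\Psi(t,\cdot)$ absolutely continuous on $\mathbb{R}$ for all $t$. Standing Assumption (G): $T\in(0,\infty]$, $V:(0,T)\times\mathbb{R}\to\mathbb{C}$, $\alpha\in(0,\frac\pi2)$, $\Omega\supseteq S_\alpha$ open, $G:(0,T)\times\mathbb{R}\times\Omega\to\mathbb{C}$ holomorphic in $z$, such that: (i) for every $z\in S_\alpha$, $G(\cdot,\cdot,z)\in\mathrm{AC}_{1,2}$ and $i\partial_tG=(-\partial_x^2+V)G$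 a.e.; (ii) there is an absolutely continuous $a:(0,T)\to(0,\infty)$ with $a(t)\to\infty$ as $t\to0^+$ such that $G(t,x,z)=e^{ia(t)(z-x)^2}\widetilde G(t,x,z)$ with $|\widetilde G(t,x,z)|\le A_0(t,x)e^{B_0(t,x)|z|}$ on $(0,T)\times\mathbb{R}\times\Omega$, $A_0,B_0\ge0$ continuous, and $A_0/\sqrt a$, $B_0$ extending continuously to $[0,T)\times\mathbb{R}$; (iii) $\lim_{t\to0^+}\widetilde G(t,x,z)/\sqrt{a(t)}=1/\sqrt{i\pi}$ for all $x,z$; (iv) $|\partial_x\widetilde G|,|\partial_x^2\widetilde G|,|\partial_t\widetilde G|\le A_1(t,x)e^{B_1(t,x)|z|}$ for $z\in S_\alpha$, with $A_1\ge0$ locally integrable and $B_1\ge0$ continuous. For $F$ holomorphic on $\Omega$ with an exponential bound $|F(z)|\le Ae^{B|z|}$, $\Psi(t,x;F):=\lim_{\varepsilon\to0^+}\int_{\mathbb{R}}e^{-\varepsilon y^2}G(t,x,y)F(y)dy$ for $t\in(0,T)$. *)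

(* Defs.v *)
From Stdlib Require Import Reals.
From Coquelicot Require Import Coquelicot.
From mathcomp Require all_boot all_order all_algebra all_classical all_reals all_analysis.
From mathcomp Require Rstruct Rstruct_topology.

Module MC.
From HB Require Import structures.
Import mathcomp.boot.ssreflect mathcomp.boot.ssrfun mathcomp.boot.ssrbool.
Import all_boot all_order all_algebra all_classical all_reals all_analysis Rstruct Rstruct_topology.
Import Order.TTheory GRing.Theory Num.Theory.
Local Open Scope classical_set_scope.
Local Open Scope ring_scope.
Local Notation RR := (Rdefinitions.R : realType).
Local Notation mu := (@lebesgue_measure RR).

Definition null2 (N : RR -> RR -> Prop) : Prop :=
  ((mu \x mu)%E).-negligible [set p : RR * RR | N p.1 p.2].

Definition loc_int2 (D : set (RR * RR)) (A : RR -> RR -> RR) : Prop :=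
  measurable_fun D (fun p : RR * RR => A p.1 p.2) /\
  forall K : set (RR * RR), K `<=` D -> compact K ->
    (\int[(mu \x mu)%E]_(p in K) `|A p.1 p.2|%:E < +oo)%E.
End MC.

Open Scope R_scope.

Definition in_oT (T : Rbar) (t : R) : Prop := 0 < t /\ Rbar_lt t T.
Definition in_cT (T : Rbar) (t : R) : Prop := 0 <= t /\ Rbar_lt t T.

(* The double sector S_alpha: z = 0 or Arg z in [0,alpha] u [pi,pi+alpha],
   written with the polar representation z = r e^{i theta}, r > 0
   (for alpha < pi/2 these theta lie in [0,2pi), so theta = Arg z). *)
Definition in_sector (alpha : R) (z : C) : Prop :=
  z = RtoC 0 \/
  exists r theta, 0 < r /\
    ((0 <= theta <= alpha) \/ (PI <= theta <= PI + alpha)) /\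
    z = (r * cos theta, r * sin theta).

Definition holo_on (U : C -> Prop) (f : C -> C) : Prop :=
  forall z, U z -> @ex_derive C_AbsRing C_NormedModule f z.

Definition cexp (w : C) : C :=
  (exp (fst w) * cos (snd w), exp (fst w) * sin (snd w)).

Definition AC_on (a b : R) (f : R -> C) : Prop :=
  forall eps, 0 < eps -> exists delta, 0 < delta /\
    forall (n : nat) (u v : nat -> R),
      (forall k, (k <= n)%nat -> a <= u k <= v k /\ v k <= b) ->
      (forall k, (k < n)%nat -> v k <= u (S k)) ->
      sum_f_R0 (fun k => v k - u k) n < delta ->
      sum_f_R0 (fun k => Cmod (Cminus (f (v k)) (f (u k)))) n < eps.

Definition locAC_on (I : R -> Prop) (f : R -> C) : Prop :=
  forall a b, I a -> I b -> a <= b -> AC_on a b f.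

Definition AC12 (T : Rbar) (psi : R -> R -> C) : Prop :=
  (forall x, locAC_on (in_oT T) (fun t => psi t x)) /\
  (forall t, in_oT T t ->
     locAC_on (fun _ => True) (psi t) /\
     exists d : R -> C,
       (forall x, @is_derive R_AbsRing C_R_NormedModule (psi t) x (d x)) /\
       locAC_on (fun _ => True) d).

Definition schrod_ae (T : Rbar) (V : R -> R -> C) (g : R -> R -> C) : Prop :=
  exists N : R -> R -> Prop, MC.null2 N /\
    forall t x, in_oT T t -> ~ N t x ->
      exists (gt : C) (d : R -> C) (gxx : C),
        @is_derive R_AbsRing C_R_NormedModule (fun s => g s x) t gt /\
        (forall y, @is_derive R_AbsRing C_R_NormedModule (g t) y (d y)) /\
        @is_derive R_AbsRing C_R_NormedModule d x gxx /\
        Cmult Ci gt = Cplus (Copp gxx) (Cmult (V t x) (g t x)).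

Definition cont_on2 (D : R -> R -> Prop) (f : R -> R -> R) : Prop :=
  forall t x, D t x -> forall eps, 0 < eps -> exists delta, 0 < delta /\
    forall s y, D s y -> Rabs (s - t) < delta -> Rabs (y - x) < delta ->
      Rabs (f s y - f t x) < eps.

Definition ext_cont_to (D D' : R -> R -> Prop) (f : R -> R -> R) : Prop :=
  exists g, cont_on2 D' g /\ forall t x, D t x -> g t x = f t x.

(* 1 / sqrt(i pi) (principal root) = pi^{-1/2} e^{-i pi/4} *)
Definition inv_sqrt_ipi : C :=
  (/ sqrt PI * cos (PI / 4), - (/ sqrt PI * sin (PI / 4))).

Definition StandingG (T : Rbar) (V : R -> R -> C) (alpha : R) (Omega : C -> Prop)
    (G : R -> R -> C -> C) : Prop :=
  Rbar_lt 0 T /\ 0 < alpha < PI / 2 /\ open Omega /\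
  (forall z, in_sector alpha z -> Omega z) /\
  (forall t x, in_oT T t -> holo_on Omega (G t x)) /\
  (forall z, in_sector alpha z ->
     AC12 T (fun t x => G t x z) /\ schrod_ae T V (fun t x => G t x z)) /\
  exists (a : R -> R) (Gt : R -> R -> C -> C) (A0 B0 A1 B1 : R -> R -> R),
    locAC_on (in_oT T) (fun t => RtoC (a t)) /\
    (forall t, in_oT T t -> 0 < a t) /\
    filterlim a (at_right 0) (Rbar_locally p_infty) /\
    (forall t x z, in_oT T t -> Omega z ->
       G t x z = Cmult (cexp (Cmult Ci (Cmult (RtoC (a t))
                   (Cmult (Cminus z (RtoC x)) (Cminus z (RtoC x))))))
                 (Gt t x z)) /\
    (forall t x z, in_oT T t -> Omega z ->
       Cmod (Gt t x z) <= A0 t x * exp (B0 t x * Cmod z)) /\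
    (forall t x, in_oT T t -> 0 <= A0 t x /\ 0 <= B0 t x) /\
    cont_on2 (fun t _ => in_oT T t) A0 /\
    cont_on2 (fun t _ => in_oT T t) B0 /\
    ext_cont_to (fun t _ => in_oT T t) (fun t _ => in_cT T t)
      (fun t x => A0 t x / sqrt (a t)) /\
    ext_cont_to (fun t _ => in_oT T t) (fun t _ => in_cT T t) B0 /\
    (forall x z, Omega z ->
       filterlim (fun t => Cmult (RtoC (/ sqrt (a t))) (Gt t x z))
         (at_right 0) (locally inv_sqrt_ipi)) /\
    (forall t x z, in_oT T t -> in_sector alpha z ->
       (forall l, @is_derive R_AbsRing C_R_NormedModule (fun y => Gt t y z) x l ->
          Cmod l <= A1 t x * exp (B1 t x * Cmod z)) /\
       (forall (d : R -> C) l,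
          (forall y, @is_derive R_AbsRing C_R_NormedModule (fun w => Gt t w z) y (d y)) ->
          @is_derive R_AbsRing C_R_NormedModule d x l ->
          Cmod l <= A1 t x * exp (B1 t x * Cmod z)) /\
       (forall l, @is_derive R_AbsRing C_R_NormedModule (fun s => Gt s x z) t l ->
          Cmod l <= A1 t x * exp (B1 t x * Cmod z))) /\
    (forall t x, in_oT T t -> 0 <= A1 t x /\ 0 <= B1 t x) /\
    MC.loc_int2 (fun p : R * R => in_oT T (fst p)) A1 /\
    cont_on2 (fun t _ => in_oT T t) B1.

Definition Psi_val (G : R -> R -> C -> C) (F : C -> C) (t x : R) (v : C) : Prop :=
  exists I : R -> C,
    (forall eps, 0 < eps ->
       is_RInt_gen (V := C_R_CompleteNormedModule)
         (fun y => Cmult (RtoC (exp (- eps * y ^ 2)))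
                         (Cmult (G t x (RtoC y)) (F (RtoC y))))
         (Rbar_locally m_infty) (Rbar_locally p_infty) (I eps)) /\
    filterlim I (at_right 0) (locally v).

(* Main.v *)
(* Fix t and x, and write the integral over R as two integrals over half-lines. For eps > 0 the
   regularized integrand decays like a Gaussian on a sector 0 <= arg z <= beta (beta small), so by
   Cauchy's theorem each half-line may be rotated by beta; on the rotated ray the factor
   exp(i a (z-x)^2) is itself a decaying Gaussian, so the limit eps -> 0 exists and equals the
   unregularized integral over the rotated ray. There the integrand is holomorphic in kappa and
   bounded, locally uniformly in kappa, by a constant times e^{-y}; Cauchy's estimates turn this
   bound into a uniform second-order Taylor remainder, which gives differentiability in kappa.

   Complex differentiability is only assumed pointwise, so Cauchy's theorem is obtained from
   Goursat's bisection on rectangles; the change of variables z = e^w turns sectors and annuli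
   into rectangles. *)
Require Import Defs.
From Stdlib Require Import Reals Lra Psatz Classical ClassicalEpsilon.
From Coquelicot Require Import Coquelicot.
Open Scope R_scope.

(** * Complex numbers and complex derivatives *)

(** On the ray of angle theta the quadratic phase has modulus exp(-a r^2 sin(2 theta)) up to a
    factor exp(O(r)). At theta = 0 this gives no decay, while the remaining factors may grow
    exponentially, so the contour cannot be turned before regularization. The factor exp(-eps z^2)
    decays where cos(2 theta) > 0, which is why beta is kept below pi/4. The constants of that decay
    blow up as eps tends to 0, but they serve only to turn the contour: on the final ray the
    Gaussian rate a sin(2 beta) is independent of eps, and the regularized integral differs from its
    limit by O(eps).

    The negative half-line is brought to the positive one by z -> -z. As sin(2 theta) has period pi,
    both half-lines turn in the same sense, each into its own half of the double sector.

    All limits are controlled by explicit bounds K e^{-y}; comparison of such bounds takes the place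
    of dominated convergence. *)

Notation CRInt := (RInt (V := C_R_CompleteNormedModule)).
Notation is_CRInt := (is_RInt (V := C_R_NormedModule)).
Notation ex_CRInt := (ex_RInt (V := C_R_NormedModule)).

Lemma Cmod_le_abs (z : C) : Cmod z <= Rabs (fst z) + Rabs (snd z).
Proof.
  unfold Cmod. apply Rsqr_incr_0_var.
  - rewrite Rsqr_sqrt by nra. unfold Rsqr.
    pose proof (pow2_abs (fst z)); pose proof (pow2_abs (snd z)).
    pose proof (Rabs_pos (fst z)); pose proof (Rabs_pos (snd z)). nra.
  - pose proof (Rabs_pos (fst z)); pose proof (Rabs_pos (snd z)). lra.
Qed.

Lemma Rabs_fst_le_Cmod (z : C) : Rabs (fst z) <= Cmod z.
Proof. eapply Rle_trans; [apply Rmax_l | apply Rmax_Cmod]. Qed.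

Lemma Rabs_snd_le_Cmod (z : C) : Rabs (snd z) <= Cmod z.
Proof. eapply Rle_trans; [apply Rmax_r | apply Rmax_Cmod]. Qed.

Lemma Cmod_minus_le (z w : C) : Cmod (z - w) <= Cmod z + Cmod w.
Proof. unfold Cminus. rewrite <- (Cmod_opp w). apply Cmod_triangle. Qed.

Lemma Cmod_minus_sym (z w : C) : Cmod (z - w) = Cmod (w - z).
Proof. rewrite <- Cmod_opp. f_equal. ring. Qed.

Lemma Cmod_norm_R (z : C) : @norm R_AbsRing C_R_NormedModule z = Cmod z.
Proof. symmetry. apply Cmod_norm. Qed.

Lemma C_ball_of_Cmod (x y : C) (e : R) :
  Cmod (y - x) < e -> @ball C_UniformSpace x e y.
Proof. intros H. exact (C_NormedModule_mixin_compat1 x y e H). Qed.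

(** The balls of [C_UniformSpace] are squares, with both coordinates within the radius; halving the
    radius puts the square inside the disc. *)
Lemma Cmod_of_C_ball (x y : C) (e : R) :
  0 < e -> @ball C_UniformSpace x (e / 2) y -> Cmod (y - x) < e.
Proof.
  intros He [H1 H2].
  apply Rle_lt_trans with (1 := Cmod_le_abs _).
  change (Rabs (fst y - fst x) < e / 2) in H1.
  change (Rabs (snd y - snd x) < e / 2) in H2.
  unfold Rminus in H1, H2. simpl. lra.
Qed.

Lemma continuous_C_iff {U : UniformSpace} (f : U -> C) (x : U) :
  continuous (T := U) (U := C_UniformSpace) f x <->
  (forall eps, 0 < eps -> exists d : posreal,
     forall y, ball x d y -> Cmod (f y - f x) < eps).
Proof.
  split.
  - intros H eps Heps.
    assert (H2 : 0 < eps / 2) by lra.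
    destruct (proj1 (filterlim_locally f (f x)) H (mkposreal _ H2)) as [d Hd].
    exists d. intros y Hy. apply Cmod_of_C_ball; [exact Heps | exact (Hd y Hy)].
  - intros H. apply filterlim_locally. intros eps.
    destruct (H eps (cond_pos eps)) as [d Hd].
    exists d. intros y Hy. apply C_ball_of_Cmod, Hd, Hy.
Qed.

Lemma continuous_C_pair {U : UniformSpace} (f g : U -> R) (x : U) :
  continuous f x -> continuous g x ->
  continuous (T := U) (U := C_UniformSpace) (fun y => (f y, g y)) x.
Proof.
  intros Hf Hg. apply continuous_C_iff. intros eps Heps.
  assert (H2 : 0 < eps / 2) by lra.
  destruct (proj1 (filterlim_locally f (f x)) Hf (mkposreal _ H2)) as [d1 H1].
  destruct (proj1 (filterlim_locally g (g x)) Hg (mkposreal _ H2)) as [d2 H3].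
  assert (Hd : 0 < Rmin d1 d2) by (apply Rmin_pos; apply cond_pos).
  exists (mkposreal _ Hd). intros y Hy.
  specialize (H1 y (ball_le _ _ _ (Rmin_l _ _) _ Hy)).
  specialize (H3 y (ball_le _ _ _ (Rmin_r _ _) _ Hy)).
  change (Rabs (f y - f x) < eps / 2) in H1.
  change (Rabs (g y - g x) < eps / 2) in H3.
  apply Rle_lt_trans with (1 := Cmod_le_abs _).
  unfold Rminus in H1, H3. simpl. lra.
Qed.

Lemma continuous_C_fst {U : UniformSpace} (f : U -> C) (x : U) :
  continuous (U := C_UniformSpace) f x -> continuous (fun y => fst (f y)) x.
Proof.
  intros H. apply (continuous_comp (V := C_UniformSpace) f fst x H).
  destruct (f x). apply continuous_fst.
Qed.

Lemma continuous_C_snd {U : UniformSpace} (f : U -> C) (x : U) :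
  continuous (U := C_UniformSpace) f x -> continuous (fun y => snd (f y)) x.
Proof.
  intros H. apply (continuous_comp (V := C_UniformSpace) f snd x H).
  destruct (f x). apply continuous_snd.
Qed.

Lemma continuous_Cmult {U : UniformSpace} (f g : U -> C) (x : U) :
  continuous (U := C_UniformSpace) f x -> continuous (U := C_UniformSpace) g x ->
  continuous (U := C_UniformSpace) (fun y => (f y * g y)%C) x.
Proof.
  intros Hf Hg. unfold Cmult.
  pose proof (continuous_C_fst f x Hf); pose proof (continuous_C_snd f x Hf).
  pose proof (continuous_C_fst g x Hg); pose proof (continuous_C_snd g x Hg).
  apply continuous_C_pair.
  - apply (continuous_minus (V := R_NormedModule)
      (fun y => fst (f y) * fst (g y)) (fun y => snd (f y) * snd (g y)));
      apply (continuous_mult (K := R_AbsRing)); assumption.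
  - apply (continuous_plus (V := R_NormedModule)
      (fun y => fst (f y) * snd (g y)) (fun y => snd (f y) * fst (g y)));
      apply (continuous_mult (K := R_AbsRing)); assumption.
Qed.

(** The weak inequality is trivial at w = z, so no punctured neighbourhood is needed. This form is
    also neutral between the two module structures on [C] that occur in the derivative lemmas. *)
Definition cderiv (f : C -> C) (z l : C) : Prop :=
  forall eps, 0 < eps -> exists delta, 0 < delta /\
    forall w, Cmod (w - z) < delta ->
      Cmod (f w - f z - l * (w - z)) <= eps * Cmod (w - z).

Lemma is_derive_cderiv (f : C -> C) (z l : C) :
  @is_derive C_AbsRing C_NormedModule f z l <-> cderiv f z l.
Proof.
  split.
  - intros [_ H] eps Heps.
    destruct (H z (fun P HP => HP) (mkposreal eps Heps)) as [d Hd].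
    exists d. split; [apply cond_pos |]. intros w Hw.
    specialize (Hd w Hw).
    change (Cmod (f w - f z - (w - z) * l) <= eps * Cmod (w - z)) in Hd.
    rewrite (Cmult_comm l). exact Hd.
  - intros H. split; [apply is_linear_scal_l |].
    intros z' Hz' eps.
    assert (E : z = z').
    { apply (is_filter_lim_locally_unique (V := AbsRing_NormedModule C_AbsRing) z z' Hz'). }
    subst z'.
    destruct (H eps (cond_pos eps)) as [d [Hd0 Hd]].
    exists (mkposreal d Hd0). intros w Hw.
    change (Cmod (f w - f z - (w - z) * l) <= eps * Cmod (w - z)).
    rewrite (Cmult_comm _ l). apply Hd, Hw.
Qed.

(** [is_derive_id], [is_derive_mult] and the inner function of [is_derive_comp] live in the ring
    seen as a module over itself. The content is the same, but the linearity record has to be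
    rebuilt. *)
Lemma is_derive_ring_cderiv (f : C -> C) (z l : C) :
  @is_derive C_AbsRing (AbsRing_NormedModule C_AbsRing) f z l <-> cderiv f z l.
Proof.
  rewrite <- is_derive_cderiv.
  split; intros [[A1 A2 A3] H]; (split; [split; assumption | exact H]).
Qed.

Lemma cderiv_const (c z : C) : cderiv (fun _ => c) z 0.
Proof. apply is_derive_cderiv. apply (is_derive_const (V := C_NormedModule)). Qed.

Lemma cderiv_id (z : C) : cderiv (fun w => w) z 1.
Proof. apply is_derive_ring_cderiv. apply (is_derive_id (K := C_AbsRing)). Qed.

Lemma cderiv_ext (f g : C -> C) (z l m : C) :
  (forall w, f w = g w) -> l = m -> cderiv f z l -> cderiv g z m.
Proof.
  intros E <- H. apply is_derive_cderiv.
  apply (is_derive_ext (V := C_NormedModule)) with f; [exact E |].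
  apply is_derive_cderiv, H.
Qed.

Lemma cderiv_plus (f g : C -> C) (z l m : C) :
  cderiv f z l -> cderiv g z m -> cderiv (fun w => f w + g w)%C z (l + m)%C.
Proof.
  rewrite <- !is_derive_cderiv. apply (is_derive_plus (V := C_NormedModule)).
Qed.

Lemma cderiv_mult (f g : C -> C) (z l m : C) :
  cderiv f z l -> cderiv g z m ->
  cderiv (fun w => f w * g w)%C z (l * g z + f z * m)%C.
Proof.
  rewrite <- !is_derive_ring_cderiv. intros Hf Hg.
  apply (is_derive_mult (K := C_AbsRing)); [exact Hf | exact Hg | exact Cmult_comm].
Qed.

Lemma cderiv_scal (c : C) (f : C -> C) (z l : C) :
  cderiv f z l -> cderiv (fun w => c * f w)%C z (c * l)%C.
Proof.
  intros H. eapply cderiv_ext; [| | exact (cderiv_mult _ _ z _ _ (cderiv_const c z) H)].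
  - reflexivity.
  - cbv beta. ring.
Qed.

Lemma cderiv_comp (f g : C -> C) (z l m : C) :
  cderiv f (g z) l -> cderiv g z m -> cderiv (fun w => f (g w)) z (m * l)%C.
Proof.
  rewrite <- is_derive_cderiv, <- is_derive_ring_cderiv, <- is_derive_cderiv.
  apply (is_derive_comp (V := C_NormedModule)).
Qed.

Lemma cderiv_affine (c z0 l z : C) : cderiv (fun w => c + l * (w - z0))%C z l.
Proof.
  eapply cderiv_ext;
    [| | exact (cderiv_plus _ _ z _ _ (cderiv_const (c - l * z0)%C z)
                 (cderiv_scal l _ z _ (cderiv_id z)))].
  - intros w; cbv beta; ring.
  - ring.
Qed.

Lemma cderiv_continuous (f : C -> C) (z l : C) :
  cderiv f z l -> continuous (T := C_UniformSpace) (U := C_UniformSpace) f z.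
Proof.
  intros H. apply continuous_C_iff. intros eps Heps.
  destruct (H 1 Rlt_0_1) as [d [Hd0 Hd]].
  pose proof (Cmod_ge_0 l) as Hl.
  assert (Hr : 0 < Rmin d (eps / (2 + Cmod l))).
  { apply Rmin_pos; [exact Hd0 | apply Rdiv_lt_0_compat; lra]. }
  assert (Hr2 : 0 < Rmin d (eps / (2 + Cmod l)) / 2) by lra.
  exists (mkposreal _ Hr2). intros w Hw.
  apply (Cmod_of_C_ball _ _ _ Hr) in Hw.
  assert (H1 : Cmod (w - z) < d) by (eapply Rlt_le_trans; [exact Hw | apply Rmin_l]).
  assert (H2 : Cmod (w - z) < eps / (2 + Cmod l))
    by (eapply Rlt_le_trans; [exact Hw | apply Rmin_r]).
  specialize (Hd w H1).
  replace (f w - f z)%C with ((f w - f z - l * (w - z)) + l * (w - z))%C by ring.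
  eapply Rle_lt_trans; [apply Cmod_triangle |]. rewrite Cmod_mult.
  apply (Rmult_lt_compat_r (2 + Cmod l)) in H2; [| lra].
  unfold Rdiv in H2. rewrite Rmult_assoc, Rinv_l in H2 by lra.
  pose proof (Cmod_ge_0 (w - z)). nra.
Qed.

Lemma is_derive_C_intro (f : R -> C) (t : R) (l : C) :
  is_derive (fun s => fst (f s)) t (fst l) -> is_derive (fun s => snd (f s)) t (snd l) ->
  is_derive (V := C_R_NormedModule) f t l.
Proof.
  intros [_ H1] [_ H2]. split; [apply is_linear_scal_l |].
  intros t' Ht' eps.
  assert (E : t = t') by exact (is_filter_lim_locally_unique (V := R_NormedModule) t t' Ht').
  subst t'.
  assert (He : 0 < eps / 2) by (pose proof (cond_pos eps); lra).
  generalize (filter_and _ _ (H1 t Ht' (mkposreal _ He)) (H2 t Ht' (mkposreal _ He))).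
  apply filter_imp. intros s [A1 A2].
  change (Rabs (fst (f s) - fst (f t) - (s - t) * fst l) <= eps / 2 * Rabs (s - t)) in A1.
  change (Rabs (snd (f s) - snd (f t) - (s - t) * snd l) <= eps / 2 * Rabs (s - t)) in A2.
  rewrite Cmod_norm_R.
  eapply Rle_trans; [apply Cmod_le_abs |].
  change (Rabs (fst (f s) - fst (f t) - (s - t) * fst l) +
    Rabs (snd (f s) - snd (f t) - (s - t) * snd l) <= eps * Rabs (s - t)).
  lra.
Qed.

Lemma is_derive_C_line (P : C -> C) (p v l : C) (t : R) :
  cderiv P (p + t * v)%C l ->
  is_derive (V := C_R_NormedModule) (fun s : R => P (p + s * v)%C) t (v * l)%C.
Proof.
  intros H. split; [apply is_linear_scal_l |].
  intros t' Ht' eps.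
  assert (E : t = t') by exact (is_filter_lim_locally_unique (V := R_NormedModule) t t' Ht').
  subst t'. clear Ht'.
  pose proof (Cmod_ge_0 v) as Hv.
  (* The summand 1 covers the case v = 0. *)
  assert (He : 0 < eps / (1 + Cmod v)) by (apply Rdiv_lt_0_compat; [apply cond_pos | lra]).
  destruct (H _ He) as [d [Hd0 Hd]].
  assert (Hd' : 0 < d / (1 + Cmod v)) by (apply Rdiv_lt_0_compat; lra).
  exists (mkposreal _ Hd'). intros s Hs.
  change (Rabs (s - t) < d / (1 + Cmod v)) in Hs.
  rewrite Cmod_norm_R, scal_R_Cmult.
  change (Cmod (P (p + RtoC s * v)%C - P (p + RtoC t * v)%C - RtoC (s - t) * (v * l))
    <= eps * Rabs (s - t)).
  apply (Rmult_lt_compat_r (1 + Cmod v)) in Hs; [| lra].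
  unfold Rdiv in Hs. rewrite Rmult_assoc, Rinv_l in Hs by lra.
  assert (E : (p + RtoC s * v - (p + RtoC t * v) = RtoC (s - t) * v)%C)
    by (rewrite RtoC_minus; ring).
  specialize (Hd (p + RtoC s * v)%C). rewrite E, Cmod_mult, Cmod_R in Hd.
  pose proof (Rabs_pos (s - t)) as Hp.
  replace (RtoC (s - t) * (v * l))%C with (l * (RtoC (s - t) * v))%C by ring.
  eapply Rle_trans; [apply Hd; nra |].
  replace (eps / (1 + Cmod v) * (Rabs (s - t) * Cmod v))
    with ((eps * Rabs (s - t)) * (Cmod v / (1 + Cmod v))) by (field; lra).
  rewrite <- (Rmult_1_r (eps * Rabs (s - t))) at 2.
  apply Rmult_le_compat_l; [pose proof (cond_pos eps); nra |].
  apply Rmult_le_reg_r with (1 + Cmod v); [lra |].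
  unfold Rdiv. rewrite Rmult_assoc, Rinv_l; lra.
Qed.

(** * Integrals of complex-valued functions of a real variable *)

Lemma Cmod_is_RInt_le (f : R -> C) (a b : R) (v : C) (M : R) :
  a <= b -> (forall x, a <= x <= b -> Cmod (f x) <= M) ->
  is_CRInt f a b v -> Cmod v <= (b - a) * M.
Proof.
  intros Hab Hf Hv. rewrite <- Cmod_norm_R.
  apply (norm_RInt_le_const (V := C_R_NormedModule)) with f; try assumption.
  intros x Hx. rewrite Cmod_norm_R. apply Hf, Hx.
Qed.

Lemma Cmod_RInt_le (f : R -> C) (a b M : R) :
  a <= b -> ex_CRInt f a b -> (forall x, a <= x <= b -> Cmod (f x) <= M) ->
  Cmod (CRInt f a b) <= (b - a) * M.
Proof.
  intros Hab Hex Hf. apply Cmod_is_RInt_le with f; try assumption.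
  exact (RInt_correct (V := C_R_CompleteNormedModule) f a b Hex).
Qed.

Lemma is_CRInt_Cmult (c : C) (f : R -> C) (a b : R) (v : C) :
  is_CRInt f a b v -> is_CRInt (fun t => c * f t)%C a b (c * v)%C.
Proof.
  intros H.
  pose proof (is_RInt_fct_extend_fst (U := R_NormedModule) (V := R_NormedModule) f a b v H) as H1.
  pose proof (is_RInt_fct_extend_snd (U := R_NormedModule) (V := R_NormedModule) f a b v H) as H2.
  apply (is_RInt_fct_extend_pair (U := R_NormedModule) (V := R_NormedModule)).
  - exact (is_RInt_minus (V := R_NormedModule) _ _ a b _ _
      (is_RInt_scal (V := R_NormedModule) _ a b (fst c) _ H1)
      (is_RInt_scal (V := R_NormedModule) _ a b (snd c) _ H2)).
  - exact (is_RInt_plus (V := R_NormedModule) _ _ a b _ _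
      (is_RInt_scal (V := R_NormedModule) _ a b (fst c) _ H2)
      (is_RInt_scal (V := R_NormedModule) _ a b (snd c) _ H1)).
Qed.

Lemma CRInt_Cmult (c : C) (f : R -> C) (a b : R) :
  ex_CRInt f a b -> CRInt (fun t => c * f t)%C a b = (c * CRInt f a b)%C.
Proof.
  intros H. apply (is_RInt_unique (V := C_R_CompleteNormedModule)), is_CRInt_Cmult.
  exact (RInt_correct (V := C_R_CompleteNormedModule) f a b H).
Qed.

(** * The complex exponential and its derivative *)

Lemma cexp_plus (z w : C) : cexp (z + w) = (cexp z * cexp w)%C.
Proof.
  unfold cexp, Cmult, Cplus; simpl. rewrite exp_plus, cos_plus, sin_plus.
  f_equal; ring.
Qed.

Lemma cexp_0 : cexp 0 = RtoC 1.
Proof. unfold cexp; simpl. rewrite exp_0, cos_0, sin_0. unfold RtoC. f_equal; ring. Qed.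

Lemma Cmod_cexp (z : C) : Cmod (cexp z) = exp (fst z).
Proof.
  unfold Cmod, cexp; simpl.
  replace (exp (fst z) * cos (snd z) * (exp (fst z) * cos (snd z) * 1) +
     exp (fst z) * sin (snd z) * (exp (fst z) * sin (snd z) * 1))
    with (Rsqr (exp (fst z)) * (Rsqr (sin (snd z)) + Rsqr (cos (snd z)))) by (unfold Rsqr; ring).
  rewrite sin2_cos2, Rmult_1_r. apply sqrt_Rsqr, Rlt_le, exp_pos.
Qed.

Lemma cexp_line (w : C) (t : R) :
  cexp (t * w) = (exp (t * fst w) * cos (t * snd w), exp (t * fst w) * sin (t * snd w)).
Proof.
  unfold cexp; simpl. rewrite Rmult_0_l, Rmult_0_l, Rminus_0_r, Rplus_0_r. reflexivity.
Qed.

Lemma is_derive_cexp_line (w : C) (t : R) :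
  is_derive (V := C_R_NormedModule) (fun s : R => cexp (s * w)) t (w * cexp (t * w))%C.
Proof.
  apply is_derive_C_intro; rewrite cexp_line.
  - apply is_derive_ext with (fun s => exp (s * fst w) * cos (s * snd w)).
    + intros s. rewrite cexp_line. reflexivity.
    + simpl. auto_derive; auto; ring.
  - apply is_derive_ext with (fun s => exp (s * fst w) * sin (s * snd w)).
    + intros s. rewrite cexp_line. reflexivity.
    + simpl. auto_derive; auto; ring.
Qed.

Lemma continuous_cexp_line (w : C) (t : R) :
  continuous (U := C_UniformSpace) (fun s : R => cexp (s * w)) t.
Proof.
  exact (ex_derive_continuous (V := C_R_NormedModule) _ t
    (ex_intro _ _ (is_derive_cexp_line w t))).
Qed.

Lemma exp_le (x y : R) : x <= y -> exp x <= exp y.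
Proof. intros [L | ->]; [left; apply exp_increasing, L | right; reflexivity]. Qed.

Lemma exp_Rmax_0 (t u : R) : 0 <= t <= 1 -> exp (t * u) <= exp (Rmax 0 u).
Proof.
  intros Ht. destruct (Rle_lt_dec (t * u) (Rmax 0 u)) as [H | H].
  - apply exp_le, H.
  - exfalso. revert H. unfold Rmax. destruct (Rle_dec 0 u); nra.
Qed.

(** Integrate w e^{sw} over s in [0, 1]; the exponential factor bounds |e^{sw}| there. For Re w <= 0
    that factor is 1, the case that later gives the regularization error. *)
Lemma Cmod_cexp_sub_1 (w : C) : Cmod (cexp w - 1) <= Cmod w * exp (Rmax 0 (fst w)).
Proof.
  assert (H := is_RInt_derive (V := C_R_CompleteNormedModule)
    (fun s : R => cexp (s * w)) (fun s : R => w * cexp (s * w))%C 0 1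
    (fun t _ => is_derive_cexp_line w t)
    (fun t _ => continuous_Cmult _ _ t (continuous_const w t) (continuous_cexp_line w t))).
  apply (Cmod_is_RInt_le _ _ _ _ (Cmod w * exp (Rmax 0 (fst w)))) in H; [| lra |].
  - change (Cmod (cexp (1 * w) - cexp (0 * w)) <=
      (1 - 0) * (Cmod w * exp (Rmax 0 (fst w)))) in H.
    rewrite Cmult_1_l, Cmult_0_l, cexp_0 in H. lra.
  - intros t Ht. rewrite Cmod_mult, Cmod_cexp.
    apply Rmult_le_compat_l; [apply Cmod_ge_0 |].
    replace (fst (RtoC t * w)%C) with (t * fst w) by (simpl; ring).
    apply exp_Rmax_0, Ht.
Qed.

(** One more integration: the remainder is the integral of w (e^{sw} - 1), to which the previous
    bound applies. *)
Lemma Cmod_cexp_sub_affine (w : C) :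
  Cmod (cexp w - 1 - w) <= Cmod w * (Cmod w * exp (Rmax 0 (fst w))).
Proof.
  assert (D : forall t : R, is_derive (V := C_R_NormedModule)
    (fun s : R => cexp (s * w) - s * w)%C t (w * (cexp (t * w) - 1))%C).
  { intros t. eapply eq_rect; [apply (is_derive_minus (V := C_R_NormedModule)) |].
    - apply is_derive_cexp_line.
    - apply is_derive_C_intro with (l := w); simpl; auto_derive; auto; ring.
    - change (w * cexp (t * w) - w = w * (cexp (t * w) - 1))%C. ring. }
  assert (H := is_RInt_derive (V := C_R_CompleteNormedModule)
    (fun s : R => cexp (s * w) - s * w)%C (fun s : R => w * (cexp (s * w) - 1))%C 0 1
    (fun t _ => D t)
    (fun t _ => continuous_Cmult _ _ t (continuous_const w t)
       (continuous_minus (V := C_R_NormedModule) _ _ t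
         (continuous_cexp_line w t) (continuous_const (RtoC 1) t)))).
  apply (Cmod_is_RInt_le _ _ _ _ (Cmod w * (Cmod w * exp (Rmax 0 (fst w))))) in H; [| lra |].
  - change (Cmod (cexp (1 * w) - 1 * w - (cexp (0 * w) - 0 * w)) <=
      (1 - 0) * (Cmod w * (Cmod w * exp (Rmax 0 (fst w))))) in H.
    rewrite Cmult_1_l, Cmult_0_l, cexp_0 in H.
    replace (cexp w - 1 - w)%C with (cexp w - w - (1 - 0))%C by ring. lra.
  - intros t Ht. rewrite Cmod_mult.
    apply Rmult_le_compat_l; [apply Cmod_ge_0 |].
    eapply Rle_trans; [apply Cmod_cexp_sub_1 |].
    rewrite Cmod_mult, Cmod_R, (Rabs_pos_eq t) by apply Ht.
    replace (fst (RtoC t * w)%C) with (t * fst w) by (simpl; ring).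
    pose proof (Cmod_ge_0 w). pose proof (exp_pos (Rmax 0 (t * fst w))).
    apply Rmult_le_compat; [nra | lra | nra |].
    assert (E : Rmax 0 (t * fst w) = t * Rmax 0 (fst w)).
    { rewrite <- RmaxRmult by apply Ht. f_equal. ring. }
    rewrite E. eapply Rle_trans; [apply exp_Rmax_0, Ht |].
    rewrite (Rmax_right 0 (Rmax 0 (fst w))) by apply Rmax_l. lra.
Qed.

Lemma cderiv_cexp (z : C) : cderiv cexp z (cexp z).
Proof.
  intros eps Heps.
  pose proof (exp_pos (fst z)) as Hz. pose proof (exp_pos 1) as H1.
  assert (Hm : 0 < exp (fst z) * exp 1) by nra.
  (* Within distance 1 of z the exponential factor is at most e, so the remainder is at most e^{Re
     z} e |w - z|^2. *)
  exists (Rmin 1 (eps / (exp (fst z) * exp 1))). split.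
  - apply Rmin_pos; [lra | apply Rdiv_lt_0_compat; assumption].
  - intros w Hw.
    assert (A1 : Cmod (w - z) < 1) by (eapply Rlt_le_trans; [exact Hw | apply Rmin_l]).
    assert (A2 : Cmod (w - z) < eps / (exp (fst z) * exp 1))
      by (eapply Rlt_le_trans; [exact Hw | apply Rmin_r]).
    replace (cexp w - cexp z - cexp z * (w - z))%C
      with (cexp z * (cexp (w - z) - 1 - (w - z)))%C.
    2: { replace (cexp w) with (cexp z * cexp (w - z))%C
           by (rewrite <- cexp_plus; f_equal; ring). ring. }
    rewrite Cmod_mult, Cmod_cexp.
    pose proof (Cmod_cexp_sub_affine (w - z)) as B.
    assert (B2 : exp (Rmax 0 (fst (w - z)%C)) <= exp 1).
    { assert (Rmax 0 (fst (w - z)%C) <= 1) as [L | ->]; [| left; apply exp_increasing, L | lra].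
      apply Rmax_lub; [lra |]. eapply Rle_trans; [apply Rle_abs |].
      eapply Rle_trans; [apply Rabs_fst_le_Cmod |]. lra. }
    pose proof (Cmod_ge_0 (w - z)) as B3.
    apply (Rmult_lt_compat_r (exp (fst z) * exp 1)) in A2; [| exact Hm].
    unfold Rdiv in A2. rewrite Rmult_assoc, Rinv_l in A2 by lra.
    apply Rle_trans with (exp (fst z) * (Cmod (w - z) * (Cmod (w - z) * exp 1))).
    + apply Rmult_le_compat_l; [lra |]. eapply Rle_trans; [exact B |].
      apply Rmult_le_compat_l; [lra |]. apply Rmult_le_compat_l; lra.
    + replace (exp (fst z) * (Cmod (w - z) * (Cmod (w - z) * exp 1)))
        with (Cmod (w - z) * (exp (fst z) * exp 1) * Cmod (w - z)) by ring.
      apply Rmult_le_compat_r; lra.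
Qed.

(** * Goursat's theorem on rectangles *)

(** The counterclockwise boundary integral of a rectangle; [Ci] appears because dz = i dy on
    vertical sides. *)
Definition contour (H : C -> C) (x1 x2 y1 y2 : R) : C :=
  (CRInt (fun x => H (x, y1)) x1 x2 + Ci * CRInt (fun y => H (x2, y)) y1 y2
   - CRInt (fun x => H (x, y2)) x1 x2 - Ci * CRInt (fun y => H (x1, y)) y1 y2)%C.

Definition rect (x1 x2 y1 y2 : R) (z : C) : Prop :=
  x1 <= fst z <= x2 /\ y1 <= snd z <= y2.

Definition cont_on (D : C -> Prop) (H : C -> C) : Prop :=
  forall z, D z -> continuous (T := C_UniformSpace) (U := C_UniformSpace) H z.

Lemma ex_CRInt_cont (f : R -> C) (a b : R) :
  a <= b -> (forall t, a <= t <= b -> continuous (U := C_UniformSpace) f t) ->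
  ex_CRInt f a b.
Proof.
  intros Hab Hf. apply (ex_RInt_continuous (V := C_R_CompleteNormedModule)).
  rewrite Rmin_left, Rmax_right by exact Hab. exact Hf.
Qed.

Section Edges.
Variables (H : C -> C) (x1 x2 y1 y2 : R).
Hypothesis HC : cont_on (rect x1 x2 y1 y2) H.

Lemma ex_CRInt_horizontal (a b y : R) :
  x1 <= a <= b -> b <= x2 -> y1 <= y <= y2 -> ex_CRInt (fun x => H (x, y)) a b.
Proof.
  intros Ha Hb Hy. apply ex_CRInt_cont; [lra |]. intros t Ht.
  apply (continuous_comp (V := C_UniformSpace) (W := C_UniformSpace) (fun x => (x, y)) H).
  - apply continuous_C_pair; [apply continuous_id | apply continuous_const].
  - apply HC. split; simpl; lra.
Qed.

Lemma ex_CRInt_vertical (a b x : R) :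
  y1 <= a <= b -> b <= y2 -> x1 <= x <= x2 -> ex_CRInt (fun y => H (x, y)) a b.
Proof.
  intros Ha Hb Hx. apply ex_CRInt_cont; [lra |]. intros t Ht.
  apply (continuous_comp (V := C_UniformSpace) (W := C_UniformSpace) (fun y => (x, y)) H).
  - apply continuous_C_pair; [apply continuous_const | apply continuous_id].
  - apply HC. split; simpl; lra.
Qed.

Lemma Cmod_contour_le (M : R) :
  x1 <= x2 -> y1 <= y2 -> (forall z, rect x1 x2 y1 y2 z -> Cmod (H z) <= M) ->
  Cmod (contour H x1 x2 y1 y2) <= 2 * ((x2 - x1) + (y2 - y1)) * M.
Proof.
  intros Hx Hy HM. unfold contour.
  eapply Rle_trans; [apply Cmod_minus_le |].
  eapply Rle_trans; [apply Rplus_le_compat_r, Cmod_minus_le |].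
  eapply Rle_trans; [apply Rplus_le_compat_r, Rplus_le_compat_r, Cmod_triangle |].
  rewrite !Cmod_mult, !Cmod_Ci, !Rmult_1_l.
  assert (A1 := Cmod_RInt_le (fun x => H (x, y1)) x1 x2 M Hx
    (ex_CRInt_horizontal x1 x2 y1 ltac:(lra) ltac:(lra) ltac:(lra))).
  assert (A2 := Cmod_RInt_le (fun x => H (x, y2)) x1 x2 M Hx
    (ex_CRInt_horizontal x1 x2 y2 ltac:(lra) ltac:(lra) ltac:(lra))).
  assert (A3 := Cmod_RInt_le (fun y => H (x1, y)) y1 y2 M Hy
    (ex_CRInt_vertical y1 y2 x1 ltac:(lra) ltac:(lra) ltac:(lra))).
  assert (A4 := Cmod_RInt_le (fun y => H (x2, y)) y1 y2 M Hy
    (ex_CRInt_vertical y1 y2 x2 ltac:(lra) ltac:(lra) ltac:(lra))).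
  specialize (A1 ltac:(intros; apply HM; split; simpl; lra)).
  specialize (A2 ltac:(intros; apply HM; split; simpl; lra)).
  specialize (A3 ltac:(intros; apply HM; split; simpl; lra)).
  specialize (A4 ltac:(intros; apply HM; split; simpl; lra)).
  lra.
Qed.

(** Each inner edge is traversed twice, in opposite directions. *)
Lemma contour_split (x y : R) :
  x1 <= x <= x2 -> y1 <= y <= y2 ->
  contour H x1 x2 y1 y2 =
    (contour H x1 x y1 y + contour H x x2 y1 y +
     (contour H x1 x y y2 + contour H x x2 y y2))%C.
Proof.
  intros Hx Hy. unfold contour.
  assert (Ch : forall t, y1 <= t <= y2 -> CRInt (fun x => H (x, t)) x1 x2 =
    (CRInt (fun x => H (x, t)) x1 x + CRInt (fun x => H (x, t)) x x2)%C).
  { intros t Ht. symmetry.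
    apply (RInt_Chasles (V := C_R_CompleteNormedModule)); apply ex_CRInt_horizontal; lra. }
  assert (Cv : forall t, x1 <= t <= x2 -> CRInt (fun y => H (t, y)) y1 y2 =
    (CRInt (fun y => H (t, y)) y1 y + CRInt (fun y => H (t, y)) y y2)%C).
  { intros t Ht. symmetry.
    apply (RInt_Chasles (V := C_R_CompleteNormedModule)); apply ex_CRInt_vertical; lra. }
  rewrite (Ch y1), (Ch y2), (Cv x1), (Cv x2) by lra. ring.
Qed.

End Edges.

Lemma contour_minus (H K : C -> C) (x1 x2 y1 y2 : R) :
  x1 <= x2 -> y1 <= y2 ->
  cont_on (rect x1 x2 y1 y2) H -> cont_on (rect x1 x2 y1 y2) K ->
  contour (fun z => H z - K z)%C x1 x2 y1 y2 =
    (contour H x1 x2 y1 y2 - contour K x1 x2 y1 y2)%C.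
Proof.
  intros Hx Hy HH HK. unfold contour.
  assert (D : forall (f g : R -> C) a b, ex_CRInt f a b -> ex_CRInt g a b ->
    CRInt (fun t => f t - g t)%C a b = (CRInt f a b - CRInt g a b)%C)
    by (intros; apply (RInt_minus (V := C_R_CompleteNormedModule)); assumption).
  assert (Eh : forall y, y1 <= y <= y2 -> CRInt (fun x => H (x, y) - K (x, y))%C x1 x2 =
    (CRInt (fun x => H (x, y)) x1 x2 - CRInt (fun x => K (x, y)) x1 x2)%C).
  { intros y Hyy. apply (D (fun x => H (x, y)) (fun x => K (x, y))).
    - apply (ex_CRInt_horizontal H x1 x2 y1 y2 HH); lra.
    - apply (ex_CRInt_horizontal K x1 x2 y1 y2 HK); lra. }
  assert (Ev : forall x, x1 <= x <= x2 -> CRInt (fun y => H (x, y) - K (x, y))%C y1 y2 =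
    (CRInt (fun y => H (x, y)) y1 y2 - CRInt (fun y => K (x, y)) y1 y2)%C).
  { intros x Hxx. apply (D (fun y => H (x, y)) (fun y => K (x, y))).
    - apply (ex_CRInt_vertical H x1 x2 y1 y2 HH); lra.
    - apply (ex_CRInt_vertical K x1 x2 y1 y2 HK); lra. }
  rewrite (Eh y1), (Eh y2), (Ev x1), (Ev x2) by lra.
  ring.
Qed.

(** An affine map has a primitive, so each side contributes a difference of corner values, and these
    telescope around the rectangle. *)
Lemma contour_affine (c z0 l : C) (x1 x2 y1 y2 : R) :
  contour (fun z => c + l * (z - z0))%C x1 x2 y1 y2 = 0.
Proof.
  set (h := fun z => (c + l * (z - z0))%C).
  set (P := fun z => (c * z + l / 2 * ((z - z0) * (z - z0)))%C).
  assert (DP : forall z, cderiv P z (h z)).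
  { intros z. pose proof (cderiv_affine 0 z0 1 z) as A.
    eapply cderiv_ext; [| | exact (cderiv_plus _ _ z _ _ (cderiv_scal c _ z _ (cderiv_id z))
       (cderiv_scal (l / 2)%C _ z _ (cderiv_mult _ _ z _ _ A A)))].
    - intros w. unfold P. cbv beta. ring.
    - unfold h. cbv beta. field. }
  assert (Ch : forall z, continuous (T := C_UniformSpace) (U := C_UniformSpace) h z)
    by (intros z; apply cderiv_continuous with l, cderiv_affine).
  (* One statement for both kinds of sides: v = 1 is horizontal, v = i vertical. *)
  assert (Line : forall (p v : C) a b,
    is_CRInt (fun t : R => v * h (p + t * v))%C a b
      (P (p + b * v) - P (p + a * v))%C).
  { intros p v a b.
    apply (is_RInt_derive (V := C_R_CompleteNormedModule)
      (fun t : R => P (p + t * v)%C) (fun t : R => v * h (p + t * v))%C).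
    - intros t _. apply is_derive_C_line, DP.
    - intros t _. apply continuous_Cmult; [apply continuous_const |].
      apply (continuous_comp (V := C_UniformSpace) (W := C_UniformSpace)); [| apply Ch].
      apply continuous_C_pair; simpl.
      + apply (ex_derive_continuous (fun t => fst p + (t * fst v - 0 * snd v))).
        auto_derive; auto.
      + apply (ex_derive_continuous (fun t => snd p + (t * snd v + 0 * fst v))).
        auto_derive; auto. }
  assert (Hor : forall y, CRInt (fun x => h (x, y)) x1 x2 = (P (x2, y) - P (x1, y))%C).
  { intros y. apply (is_RInt_unique (V := C_R_CompleteNormedModule)).
    replace (x2, y) with ((0, y) + x2 * 1)%C by (unfold Cplus, Cmult; simpl; f_equal; ring).
    replace (x1, y) with ((0, y) + x1 * 1)%C by (unfold Cplus, Cmult; simpl; f_equal; ring).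
    eapply is_RInt_ext; [| apply Line]. intros t _. cbv beta.
    rewrite Cmult_1_l. f_equal. unfold Cplus, Cmult; simpl; f_equal; ring. }
  assert (Ver : forall x, (Ci * CRInt (fun y => h (x, y)) y1 y2 = P (x, y2) - P (x, y1))%C).
  { intros x.
    (* [Line] with v = i yields i times the vertical integral; the factor -i = 1/i isolates the
       integral itself. *)
    assert (E : CRInt (fun y => h (x, y)) y1 y2 = ((- Ci) * (P (x, y2) - P (x, y1)))%C).
    { apply (is_RInt_unique (V := C_R_CompleteNormedModule)).
      replace (x, y2) with ((x, 0) + y2 * Ci)%C by (unfold Cplus, Cmult; simpl; f_equal; ring).
      replace (x, y1) with ((x, 0) + y1 * Ci)%C by (unfold Cplus, Cmult; simpl; f_equal; ring).
      eapply is_RInt_ext; [| apply is_CRInt_Cmult, Line]. intros t _. cbv beta.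
      replace (- Ci * (Ci * h ((x, 0) + t * Ci)))%C with (h ((x, 0) + t * Ci)%C).
      - f_equal. unfold Cplus, Cmult; simpl; f_equal; ring.
      - rewrite Cmult_assoc. replace (- Ci * Ci)%C with (RtoC 1); [ring |].
        unfold Ci, Cmult, Copp, RtoC; simpl; f_equal; ring. }
    rewrite E, Cmult_assoc. replace (Ci * - Ci)%C with (RtoC 1); [ring |].
    unfold Ci, Cmult, Copp, RtoC; simpl; f_equal; ring. }
  unfold contour. rewrite !Hor, !Ver. ring.
Qed.

(** * Bisection and Goursat's theorem *)

Lemma nested_intervals (lo hi : nat -> R) :
  (forall n, lo n <= lo (S n)) -> (forall n, hi (S n) <= hi n) ->
  (forall n, lo n <= hi n) -> exists u, forall n, lo n <= u <= hi n.
Proof.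
  intros Hlo Hhi Hle.
  assert (Mlo : forall n k, lo n <= lo (n + k)%nat).
  { intros n k. induction k; [rewrite Nat.add_0_r; lra |].
    rewrite Nat.add_succ_r. pose proof (Hlo (n + k)%nat). lra. }
  assert (Mhi : forall n k, hi (n + k)%nat <= hi n).
  { intros n k. induction k; [rewrite Nat.add_0_r; lra |].
    rewrite Nat.add_succ_r. pose proof (Hhi (n + k)%nat). lra. }
  assert (B : forall m n, lo m <= hi n).
  { intros m n. pose proof (Mlo m n). pose proof (Mhi n m). pose proof (Hle (m + n)%nat).
    rewrite (Nat.add_comm n m) in *. lra. }
  destruct (completeness (fun r => exists n, r = lo n)) as [u [U1 U2]].
  - exists (hi 0%nat). intros r [n ->]. apply B.
  - exists (lo 0%nat), 0%nat. reflexivity.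
  - exists u. intros n. split; [apply U1; exists n; reflexivity |].
    apply U2. intros r [m ->]. apply B.
Qed.

(** Compactness in the form of bisection: if P failed, one could go on choosing a bad quarter, and
    these rectangles would shrink to a point (u, v) where the local hypothesis contradicts their
    badness. That hypothesis concerns only rectangles containing (u, v), which is what
    differentiability at a single point can supply. *)
Lemma bisection2 (P : R -> R -> R -> R -> Prop) (x1 x2 y1 y2 : R) :
  x1 <= x2 -> y1 <= y2 ->
  (forall a b c d, a <= b -> c <= d ->
     P a ((a + b) / 2) c ((c + d) / 2) -> P ((a + b) / 2) b c ((c + d) / 2) ->
     P a ((a + b) / 2) ((c + d) / 2) d -> P ((a + b) / 2) b ((c + d) / 2) d ->
     P a b c d) ->
  (forall u v, x1 <= u <= x2 -> y1 <= v <= y2 -> exists delta, 0 < delta /\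
     forall a b c d, x1 <= a <= u -> u <= b <= x2 -> y1 <= c <= v -> v <= d <= y2 ->
       b - a < delta -> d - c < delta -> P a b c d) ->
  P x1 x2 y1 y2.
Proof.
  intros Hx Hy Hsplit Hloc. apply NNPP. intros HN.
  (* A rectangle [a, b] x [c, d] is encoded as ((a, b), (c, d)). *)
  set (Q := (R * R * (R * R))%type).
  set (bad := fun q : Q => ~ P (fst (fst q)) (snd (fst q)) (fst (snd q)) (snd (snd q))).
  set (ok := fun q : Q => fst (fst q) <= snd (fst q) /\ fst (snd q) <= snd (snd q)).
  set (half := fun q q' : Q =>
    (fst q' = (fst (fst q), (fst (fst q) + snd (fst q)) / 2) \/
     fst q' = ((fst (fst q) + snd (fst q)) / 2, snd (fst q))) /\
    (snd q' = (fst (snd q), (fst (snd q) + snd (snd q)) / 2) \/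
     snd q' = ((fst (snd q) + snd (snd q)) / 2, snd (snd q)))).
  (* The conditions stand behind the existential, so that [next] is a total function and no proof is
     carried along the iteration. *)
  assert (Step : forall q, exists q', ok q -> bad q -> half q q' /\ bad q').
  { intros q. destruct (classic (ok q /\ bad q)) as [[O B] | N];
      [| exists q; intros; exfalso; tauto].
    apply NNPP. intros Hno. apply B. destruct O as [O1 O2].
    apply Hsplit; try assumption; apply NNPP; intros Hbad; apply Hno.
    - exists ((fst (fst q), (fst (fst q) + snd (fst q)) / 2),
              (fst (snd q), (fst (snd q) + snd (snd q)) / 2)).
      intros _ _. split; [split; left; reflexivity | exact Hbad].
    - exists (((fst (fst q) + snd (fst q)) / 2, snd (fst q)),
              (fst (snd q), (fst (snd q) + snd (snd q)) / 2)).
      intros _ _. split; [split; [right | left]; reflexivity | exact Hbad].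
    - exists ((fst (fst q), (fst (fst q) + snd (fst q)) / 2),
              ((fst (snd q) + snd (snd q)) / 2, snd (snd q))).
      intros _ _. split; [split; [left | right]; reflexivity | exact Hbad].
    - exists (((fst (fst q) + snd (fst q)) / 2, snd (fst q)),
              ((fst (snd q) + snd (snd q)) / 2, snd (snd q))).
      intros _ _. split; [split; right; reflexivity | exact Hbad]. }
  set (next := fun q => proj1_sig (constructive_indefinite_description _ (Step q))).
  assert (Hnext : forall q, ok q -> bad q -> half q (next q) /\ bad (next q)).
  { intros q. exact (proj2_sig (constructive_indefinite_description _ (Step q))). }
  set (s := nat_rect (fun _ => Q) ((x1, x2), (y1, y2)) (fun _ q => next q)).
  assert (Hs : forall n, ok (s n) /\ bad (s n)).
  { induction n as [| n [O B]]; [split; [split; assumption | exact HN] |].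
    change (s (S n)) with (next (s n)).
    destruct (Hnext _ O B) as [[H1 H2] B']. split; [| exact B'].
    destruct O as [O1 O2]. split.
    - destruct H1 as [-> | ->]; simpl; lra.
    - destruct H2 as [-> | ->]; simpl; lra. }
  assert (Hhalf : forall n, half (s n) (s (S n))).
  { intros n. destruct (Hs n) as [O B]. exact (proj1 (Hnext _ O B)). }
  destruct (nested_intervals (fun n => fst (fst (s n))) (fun n => snd (fst (s n)))) as [u Hu].
  { intros n. destruct (Hhalf n) as [H1 _]. destruct (Hs n) as [[O1 _] _].
    destruct H1 as [-> | ->]; simpl; lra. }
  { intros n. destruct (Hhalf n) as [H1 _]. destruct (Hs n) as [[O1 _] _].
    destruct H1 as [-> | ->]; simpl; lra. }
  { intros n. apply (Hs n). }
  destruct (nested_intervals (fun n => fst (snd (s n))) (fun n => snd (snd (s n)))) as [v Hv].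
  { intros n. destruct (Hhalf n) as [_ H1]. destruct (Hs n) as [[_ O1] _].
    destruct H1 as [-> | ->]; simpl; lra. }
  { intros n. destruct (Hhalf n) as [_ H1]. destruct (Hs n) as [[_ O1] _].
    destruct H1 as [-> | ->]; simpl; lra. }
  { intros n. apply (Hs n). }
  assert (Bx : forall n, x1 <= fst (fst (s n)) /\ snd (fst (s n)) <= x2).
  { induction n as [| n IH]; [simpl; lra |].
    destruct (Hhalf n) as [H1 _]. destruct (Hs n) as [[O1 _] _].
    destruct H1 as [-> | ->]; simpl; lra. }
  assert (By : forall n, y1 <= fst (snd (s n)) /\ snd (snd (s n)) <= y2).
  { induction n as [| n IH]; [simpl; lra |].
    destruct (Hhalf n) as [_ H1]. destruct (Hs n) as [[_ O1] _].
    destruct H1 as [-> | ->]; simpl; lra. }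
  assert (Lx : forall n, snd (fst (s n)) - fst (fst (s n)) = (x2 - x1) * (/ 2) ^ n).
  { induction n as [| n IH]; [simpl; lra |].
    destruct (Hhalf n) as [H1 _]. rewrite <- tech_pow_Rmult.
    destruct H1 as [-> | ->]; simpl; lra. }
  assert (Ly : forall n, snd (snd (s n)) - fst (snd (s n)) = (y2 - y1) * (/ 2) ^ n).
  { induction n as [| n IH]; [simpl; lra |].
    destruct (Hhalf n) as [_ H1]. rewrite <- tech_pow_Rmult.
    destruct H1 as [-> | ->]; simpl; lra. }
  destruct (Hloc u v) as [delta [Hd Hl]].
  { pose proof (Hu 0%nat). simpl in *. lra. }
  { pose proof (Hv 0%nat). simpl in *. lra. }
  (* The sides have shrunk by 2^-n; the summand 1 keeps the denominator positive for a degenerate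
     rectangle. *)
  destruct (pow_lt_1_zero (/ 2) ltac:(rewrite Rabs_pos_eq; lra)
    (delta / (1 + (x2 - x1) + (y2 - y1)))) as [n Hn].
  { apply Rdiv_lt_0_compat; lra. }
  specialize (Hn n (Nat.le_refl n)).
  assert (Hp : 0 < (/ 2) ^ n) by (apply pow_lt; lra).
  rewrite Rabs_pos_eq in Hn by lra.
  apply (Rmult_lt_compat_r (1 + (x2 - x1) + (y2 - y1))) in Hn; [| lra].
  unfold Rdiv in Hn. rewrite Rmult_assoc, Rinv_l in Hn by lra.
  apply (proj2 (Hs n)).
  pose proof (Hu n). pose proof (Hv n). pose proof (Bx n). pose proof (By n).
  apply Hl; try lra; rewrite ?Lx, ?Ly; nra.
Qed.

(** The bound eps (b - a + d - c)^2 is reproduced exactly by quartering: four quarters, each with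
    half the semiperimeter. On a small rectangle, subtracting the tangent affine map does not change
    the contour integral; the difference is at most eps/2 times the semiperimeter, and the boundary
    is twice the semiperimeter long. *)
Lemma goursat (H : C -> C) (x1 x2 y1 y2 : R) :
  x1 <= x2 -> y1 <= y2 ->
  (forall z, rect x1 x2 y1 y2 z -> exists l, cderiv H z l) ->
  contour H x1 x2 y1 y2 = 0.
Proof.
  intros Hx Hy HD.
  assert (HC : cont_on (rect x1 x2 y1 y2) H).
  { intros z Hz. destruct (HD z Hz) as [l Hl]. exact (cderiv_continuous _ _ _ Hl). }
  assert (Sub : forall a b c d, x1 <= a -> b <= x2 -> y1 <= c -> d <= y2 ->
    cont_on (rect a b c d) H).
  { intros a b c d ? ? ? ? z [? ?]. apply HC. split; lra. }
  set (L := (x2 - x1) + (y2 - y1)).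
  assert (Small : forall eps, 0 < eps -> Cmod (contour H x1 x2 y1 y2) <= eps * (L * L)).
  { intros eps Heps.
    (* Inclusion in the original rectangle becomes part of the property, because the splitting step
       of [bisection2] ranges over all rectangles. *)
    cut (x1 <= x1 -> x2 <= x2 -> y1 <= y1 -> y2 <= y2 ->
      Cmod (contour H x1 x2 y1 y2) <= eps * (L * L)).
    { intros K. apply K; lra. }
    unfold L.
    apply (bisection2 (fun a b c d => x1 <= a -> b <= x2 -> y1 <= c -> d <= y2 ->
      Cmod (contour H a b c d) <= eps * ((b - a + (d - c)) * (b - a + (d - c))))
      x1 x2 y1 y2 Hx Hy).
    - intros a b c d Hab Hcd P1 P2 P3 P4 Ha Hb Hc Hd.
      rewrite (contour_split H a b c d (Sub a b c d Ha Hb Hc Hd) ((a + b) / 2) ((c + d) / 2))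
        by lra.
      specialize (P1 ltac:(lra) ltac:(lra) ltac:(lra) ltac:(lra)).
      specialize (P2 ltac:(lra) ltac:(lra) ltac:(lra) ltac:(lra)).
      specialize (P3 ltac:(lra) ltac:(lra) ltac:(lra) ltac:(lra)).
      specialize (P4 ltac:(lra) ltac:(lra) ltac:(lra) ltac:(lra)).
      eapply Rle_trans; [apply Cmod_triangle |].
      eapply Rle_trans; [apply Rplus_le_compat; apply Cmod_triangle |].
      nra.
    - intros u v Hu Hv.
      destruct (HD (u, v)) as [l Hl]; [split; simpl; lra |].
      assert (He : 0 < eps / 2) by lra.
      destruct (Hl _ He) as [d0 [Hd0 Hd]].
      (* Two sides shorter than d0 / 2 keep the whole rectangle within d0 of (u, v). *)
      exists (d0 / 2). split; [lra |].
      intros a b c d Ha Hb Hc Hdd S1 S2 _ _ _ _.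
      set (K := fun z => (H (u, v) + l * (z - (u, v)))%C).
      assert (HK : cont_on (rect a b c d) K).
      { intros z _. apply cderiv_continuous with l, cderiv_affine. }
      assert (HHc : cont_on (rect a b c d) H) by (apply Sub; lra).
      replace (contour H a b c d) with (contour (fun z => H z - K z)%C a b c d).
      2: { rewrite contour_minus; [| lra | lra | exact HHc | exact HK].
           unfold K. rewrite contour_affine. ring. }
      eapply Rle_trans.
      + apply (Cmod_contour_le _ _ _ _ _) with (M := eps / 2 * ((b - a) + (d - c))).
        * intros z Hz. apply (continuous_minus (V := C_R_NormedModule));
            [apply HHc, Hz | apply HK, Hz].
        * lra.
        * lra.
        * intros z [Z1 Z2].
          assert (Zd : Cmod (z - (u, v)) <= (b - a) + (d - c)).
          { eapply Rle_trans; [apply Cmod_le_abs |].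
            apply Rplus_le_compat; apply Rabs_le; simpl; lra. }
          specialize (Hd z ltac:(lra)).
          replace (H z - K z)%C with (H z - H (u, v) - l * (z - (u, v)))%C
            by (unfold K; ring).
          eapply Rle_trans; [exact Hd |]. apply Rmult_le_compat_l; lra.
      + apply Req_le. field. }
  apply Cmod_eq_0, Rle_antisym; [| apply Cmod_ge_0].
  apply le_epsilon. intros e He.
  assert (HL : 0 <= L * L) by (unfold L; nra).
  assert (Hq : 0 < e / (1 + L * L)) by (apply Rdiv_lt_0_compat; lra).
  specialize (Small _ Hq). rewrite Rplus_0_l.
  eapply Rle_trans; [exact Small |].
  apply Rmult_le_reg_r with (1 + L * L); [lra |].
  replace (e / (1 + L * L) * (L * L) * (1 + L * L)) with (e * (L * L)) by (field; lra).
  nra.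
Qed.

(** * Exponential coordinates and Cauchy estimates *)

(* The two sides may live in a canonical-structure alias of [C], which [ring] does not see. *)
Ltac Cring :=
  lazymatch goal with |- @eq _ ?a ?b => change (@eq C a b) end; apply Ceq_minus; ring.

Lemma cexp_polar (s theta : R) : cexp (s, theta) = (exp s * cexp (0%R, theta))%C.
Proof. unfold cexp, Cmult, RtoC; simpl. rewrite exp_0. f_equal; ring. Qed.

Lemma Cmod_cis (theta : R) : Cmod (cexp (0, theta)) = 1.
Proof. rewrite Cmod_cexp. apply exp_0. Qed.

Lemma continuous_C_ray (c : C) (t : R) :
  continuous (U := C_UniformSpace) (fun s : R => (s * c)%C) t.
Proof.
  apply continuous_C_pair; simpl.
  - apply (ex_derive_continuous (fun t => t * fst c - 0 * snd c)). auto_derive; auto.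
  - apply (ex_derive_continuous (fun t => t * snd c + 0 * fst c)). auto_derive; auto.
Qed.

Lemma continuous_on_ray (f : C -> C) (c l : C) (t : R) :
  cderiv f (t * c)%C l -> continuous (U := C_UniformSpace) (fun s : R => f (s * c)%C) t.
Proof.
  intros H. apply (continuous_comp (V := C_UniformSpace) (W := C_UniformSpace)).
  - apply continuous_C_ray.
  - apply cderiv_continuous with l, H.
Qed.

(** The form f(z) dz pulls back to f(e^w) e^w dw under z = e^w; on a ray this is the real
    substitution y = e^s. *)
Lemma CRInt_exp_ray (f : C -> C) (theta a b : R) :
  0 < a <= b ->
  (forall r, a <= r <= b -> exists l, cderiv f (r * cexp (0%R, theta))%C l) ->
  CRInt (fun s => f (cexp (s, theta)) * cexp (s, theta))%C (ln a) (ln b) =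
  CRInt (fun y : R => cexp (0%R, theta) * f (y * cexp (0%R, theta)))%C a b.
Proof.
  intros Hab Hf.
  assert (Hln : ln a <= ln b).
  { destruct (proj2 Hab) as [L | ->]; [left; apply ln_increasing; lra | lra]. }
  rewrite <- (exp_ln a) at 2 by lra. rewrite <- (exp_ln b) at 2 by lra.
  rewrite <- (RInt_comp (V := C_R_CompleteNormedModule)
    (fun y : R => cexp (0%R, theta) * f (y * cexp (0%R, theta)))%C exp exp).
  - apply (RInt_ext (V := C_R_CompleteNormedModule)). intros s _.
    rewrite scal_R_Cmult, cexp_polar. Cring.
  - intros s Hs. rewrite Rmin_left, Rmax_right in Hs by exact Hln.
    assert (Hr : a <= exp s <= b).
    { rewrite <- (exp_ln a), <- (exp_ln b) by lra.
      split; apply exp_le; lra. }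
    destruct (Hf _ Hr) as [l Hl].
    apply continuous_Cmult; [apply continuous_const |].
    apply continuous_on_ray with l, Hl.
  - intros s _. split; [apply is_derive_Reals, derivable_pt_lim_exp | apply continuous_exp].
Qed.

(** Under z = e^w the annular sector is a rectangle, to which [goursat] applies. Its horizontal
    sides are the two rays; its vertical sides are the arcs, of lengths beta a and beta b, and these
    give the bound. *)
Lemma Cmod_sector_rotation_le (f : C -> C) (beta a b Ma Mb : R) :
  0 <= beta -> 0 < a <= b ->
  (forall r theta, a <= r <= b -> 0 <= theta <= beta ->
     exists l, cderiv f (r * cexp (0%R, theta))%C l) ->
  (forall theta, 0 <= theta <= beta -> Cmod (f (a * cexp (0%R, theta))%C) <= Ma) ->
  (forall theta, 0 <= theta <= beta -> Cmod (f (b * cexp (0%R, theta))%C) <= Mb) ->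
  Cmod (CRInt (fun y : R => f y) a b -
        CRInt (fun y : R => cexp (0%R, beta) * f (y * cexp (0%R, beta)))%C a b)
    <= beta * (a * Ma + b * Mb).
Proof.
  intros Hb Hab Hf HMa HMb.
  set (H := fun w => (f (cexp w) * cexp w)%C).
  assert (Hln : ln a <= ln b).
  { destruct (proj2 Hab) as [L | ->]; [left; apply ln_increasing; lra | lra]. }
  assert (HD : forall z, rect (ln a) (ln b) 0 beta z -> exists l, cderiv H z l).
  { intros [s theta] [H1 H2]; simpl in H1, H2.
    destruct (Hf (exp s) theta) as [l Hl]; [| exact H2 |].
    { rewrite <- (exp_ln a), <- (exp_ln b) by lra. split; apply exp_le; lra. }
    rewrite <- cexp_polar in Hl.
    eexists. apply cderiv_mult; [| apply cderiv_cexp].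
    apply cderiv_comp; [exact Hl | apply cderiv_cexp]. }
  assert (HC : cont_on (rect (ln a) (ln b) 0 beta) H).
  { intros z Hz. destruct (HD z Hz) as [l Hl]. exact (cderiv_continuous _ _ _ Hl). }
  pose proof (goursat H (ln a) (ln b) 0 beta Hln Hb HD) as G.
  unfold contour in G.
  assert (E0 : CRInt (fun s => H (s, 0)) (ln a) (ln b) = CRInt (fun y : R => f y) a b).
  { unfold H. rewrite CRInt_exp_ray by (try exact Hab; intros; apply Hf; lra).
    apply (RInt_ext (V := C_R_CompleteNormedModule)). intros y _.
    change (0, 0) with (RtoC 0). rewrite cexp_0, Cmult_1_l, Cmult_1_r. reflexivity. }
  assert (E1 : CRInt (fun s => H (s, beta)) (ln a) (ln b) =
    CRInt (fun y : R => cexp (0%R, beta) * f (y * cexp (0%R, beta)))%C a b).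
  { unfold H. apply CRInt_exp_ray; [exact Hab | intros; apply Hf; lra]. }
  rewrite E0, E1 in G.
  assert (Side : forall c M, a <= c <= b ->
    (forall theta, 0 <= theta <= beta -> Cmod (f (c * cexp (0%R, theta))%C) <= M) ->
    Cmod (CRInt (fun y => H (ln c, y)) 0 beta) <= beta * (c * M)).
  { intros c M Hc HM.
    replace (beta * (c * M)) with ((beta - 0) * (c * M)) by ring.
    apply Cmod_RInt_le; [exact Hb | |].
    - apply (ex_CRInt_vertical H _ _ _ _ HC); try lra.
      split.
      + destruct (proj1 Hc) as [L | ->]; [left; apply ln_increasing; lra | lra].
      + destruct (proj2 Hc) as [L | ->]; [left; apply ln_increasing; lra | lra].
    - intros theta Ht. unfold H. rewrite Cmod_mult, Cmod_cexp.
      rewrite cexp_polar. simpl fst. rewrite exp_ln by lra.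
      specialize (HM theta Ht). pose proof (Cmod_ge_0 (f (c * cexp (0%R, theta))%C)). nra. }
  pose proof (Side a Ma ltac:(lra) HMa) as S1.
  pose proof (Side b Mb ltac:(lra) HMb) as S2.
  set (I0 := CRInt (fun y : R => f y) a b) in *.
  set (I1 := CRInt (fun y : R => cexp (0%R, beta) * f (y * cexp (0%R, beta)))%C a b) in *.
  set (J0 := CRInt (fun y => H (ln a, y)) 0 beta) in *.
  set (J1 := CRInt (fun y => H (ln b, y)) 0 beta) in *.
  replace (I0 - I1)%C with ((I0 + Ci * J1 - I1 - Ci * J0) + Ci * (J0 - J1))%C by ring.
  rewrite G, Cplus_0_l, Cmod_mult, Cmod_Ci, Rmult_1_l.
  eapply Rle_trans; [apply Cmod_minus_le |]. lra.
Qed.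

(** * Cauchy's formula for the derivative, on circles in exponential coordinates *)

Lemma cexp_2PI (s : R) : cexp (s, 2 * PI) = cexp (s, 0).
Proof. unfold cexp; simpl. rewrite cos_2PI, sin_2PI, cos_0, sin_0. reflexivity. Qed.

(* With [u = z + cexp (s, theta)], this is [-i] times the integral of [k u / (u - z)^2 du] over
   the circle of radius [exp s]. *)
Definition circle_integral (k : C -> C) (z : C) (s : R) : C :=
  CRInt (fun theta => k (z + cexp (s, theta)) * cexp (- (s, theta)))%C 0 (2 * PI).

Lemma cderiv_circle_integrand (k : C -> C) (z w l : C) :
  cderiv k (z + cexp w)%C l ->
  exists m, cderiv (fun w => k (z + cexp w) * cexp (- w))%C w m.
Proof.
  intros Hl. eexists. apply cderiv_mult.
  - apply cderiv_comp; [exact Hl |].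
    apply cderiv_plus; [apply cderiv_const | apply cderiv_cexp].
  - apply (cderiv_comp cexp (fun w => - w)%C); [apply cderiv_cexp |].
    eapply cderiv_ext; [| reflexivity | apply (cderiv_affine 0 0 (- (1))%C)].
    intros u. cbv beta. ring.
Qed.

Section Circles.
Variables (k : C -> C) (z : C) (r : R).
Hypothesis Hk : forall w, Cmod (w - z) <= r -> exists l, cderiv k w l.

Lemma circle_integrand_diff (s theta : R) :
  exp s <= r -> exists m, cderiv (fun w => k (z + cexp w) * cexp (- w))%C (s, theta) m.
Proof.
  intros Hs. destruct (Hk (z + cexp (s, theta))%C) as [l Hl].
  - replace (z + cexp (s, theta) - z)%C with (cexp (s, theta)) by ring.
    rewrite Cmod_cexp. exact Hs.
  - apply cderiv_circle_integrand with l, Hl.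
Qed.

Lemma ex_circle_integral (s : R) : exp s <= r ->
  ex_CRInt (fun theta => k (z + cexp (s, theta)) * cexp (- (s, theta)))%C 0 (2 * PI).
Proof.
  intros Hs. pose proof PI_RGT_0.
  apply (ex_CRInt_vertical (fun w => k (z + cexp w) * cexp (- w))%C s s 0 (2 * PI)); try lra.
  intros [s' theta] [Hs' _]. simpl in Hs'. assert (s' = s) as -> by lra.
  destruct (circle_integrand_diff s theta Hs) as [m Hm].
  exact (cderiv_continuous _ _ _ Hm).
Qed.

(** The annulus is the image of [s1, s2] x [0, 2 pi]; by periodicity the horizontal sides cancel,
    and Goursat equates the vertical ones. *)
Lemma circle_integral_indep (s1 s2 : R) :
  s1 <= s2 -> exp s2 <= r -> circle_integral k z s1 = circle_integral k z s2.
Proof.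
  intros H12 Hr. pose proof PI_RGT_0.
  set (H0 := fun w => (k (z + cexp w) * cexp (- w))%C).
  assert (G : contour H0 s1 s2 0 (2 * PI) = 0).
  { apply goursat; try lra. intros [s theta] [Hs _]. simpl in Hs.
    apply circle_integrand_diff. apply Rle_trans with (exp s2); [apply exp_le; lra | exact Hr]. }
  assert (E : CRInt (fun x => H0 (x, 2 * PI)) s1 s2 = CRInt (fun x => H0 (x, 0)) s1 s2).
  { apply (RInt_ext (V := C_R_CompleteNormedModule)). intros x _.
    unfold H0. rewrite cexp_2PI. f_equal.
    unfold cexp, Copp; simpl. rewrite !cos_neg, !sin_neg, cos_2PI, sin_2PI, cos_0, sin_0.
    reflexivity. }
  unfold contour in G. rewrite E in G.
  change (CRInt (fun y => H0 (s1, y)) 0 (2 * PI)) with (circle_integral k z s1) in G.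
  change (CRInt (fun y => H0 (s2, y)) 0 (2 * PI)) with (circle_integral k z s2) in G.
  assert (G2 : (Ci * (circle_integral k z s2 - circle_integral k z s1) = 0)%C)
    by (rewrite <- G; ring).
  assert (G3 : (circle_integral k z s2 - circle_integral k z s1 = 0)%C).
  { replace (circle_integral k z s2 - circle_integral k z s1)%C
      with (- Ci * (Ci * (circle_integral k z s2 - circle_integral k z s1)))%C.
    - rewrite G2. ring.
    - rewrite Cmult_assoc. replace (- Ci * Ci)%C with (RtoC 1); [ring |].
      unfold Ci, Cmult, Copp, RtoC; simpl; f_equal; ring. }
  symmetry. apply Ceq_minus, G3.
Qed.

(** Here k(z + u) = o(u), so the integrand k(z + u) / u tends to 0 on small circles, while the
    integral does not depend on the radius. *)
Lemma circle_integral_flat (s : R) :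
  exp s <= r -> cderiv k z 0 -> k z = 0 -> circle_integral k z s = 0.
Proof.
  intros Hs D0 K0. pose proof PI_RGT_0.
  apply Cmod_eq_0, Rle_antisym; [| apply Cmod_ge_0].
  apply le_epsilon. intros e He. rewrite Rplus_0_l.
  assert (He' : 0 < e / (2 * PI)) by (apply Rdiv_lt_0_compat; lra).
  destruct (D0 _ He') as [d [Hd0 Hd]].
  (* A circle of radius at most d / 2, and no larger than the given one. *)
  set (s1 := Rmin s (ln (d / 2))).
  rewrite <- (circle_integral_indep s1 s); [| apply Rmin_l | exact Hs].
  assert (Es : exp s1 <= d / 2).
  { rewrite <- (exp_ln (d / 2)) by lra. apply exp_le, Rmin_r. }
  assert (Er : exp s1 <= r).
  { apply Rle_trans with (exp s); [apply exp_le, Rmin_l | exact Hs]. }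
  replace e with ((2 * PI - 0) * (e / (2 * PI))) by (field; lra).
  apply Cmod_RInt_le; [lra | apply ex_circle_integral, Er |].
  intros theta _. rewrite Cmod_mult, Cmod_cexp.
  specialize (Hd (z + cexp (s1, theta))%C).
  replace (z + cexp (s1, theta) - z)%C with (cexp (s1, theta)) in Hd by ring.
  rewrite Cmod_cexp, K0 in Hd.
  replace (k (z + cexp (s1, theta)) - 0 - 0 * cexp (s1, theta))%C
    with (k (z + cexp (s1, theta))%C) in Hd by ring.
  simpl fst in *. specialize (Hd ltac:(lra)).
  rewrite exp_Ropp. pose proof (exp_pos s1).
  apply Rmult_le_reg_r with (exp s1); [assumption |].
  rewrite Rmult_assoc, Rinv_l, Rmult_1_r by lra. exact Hd.
Qed.
End Circles.

Lemma is_CRInt_circle_inverse (s : R) :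
  is_CRInt (fun theta => cexp (- (s, theta))%C) 0 (2 * PI) (RtoC 0).
Proof.
  (* This is i e^{-(s + i theta)}, a primitive of the integrand. *)
  set (P := fun theta => (exp (- s) * sin theta, exp (- s) * cos theta) : C).
  replace (RtoC 0) with (P (2 * PI)%R - P 0%R)%C.
  2: { unfold P. rewrite sin_2PI, cos_2PI, sin_0, cos_0. unfold Cminus. ring. }
  apply (is_RInt_derive (V := C_R_CompleteNormedModule) P (fun theta => cexp (- (s, theta))%C)).
  - intros t _. unfold P. apply is_derive_C_intro; simpl; auto_derive; auto.
    + rewrite cos_neg. ring.
    + rewrite sin_neg. ring.
  - intros t _. unfold cexp; simpl. apply continuous_C_pair.
    + apply (ex_derive_continuous (fun t => exp (- s) * cos (- t))). auto_derive; auto.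
    + apply (ex_derive_continuous (fun t => exp (- s) * sin (- t))). auto_derive; auto.
Qed.

(** Subtracting the first-order Taylor polynomial leaves a flat function, whose integral is 0. The
    constant term integrates to 0 against 1 / u, and the linear term contributes l over the angle 2
    pi. *)
Lemma cauchy_derivative_formula (h : C -> C) (z l : C) (s : R) :
  (forall w, Cmod (w - z) <= exp s -> exists m, cderiv h w m) -> cderiv h z l ->
  circle_integral h z s = (RtoC (2 * PI) * l)%C.
Proof.
  intros Hh Hl.
  set (k := fun w => (h w + (- h z + (- l) * (w - z)))%C).
  assert (Dk : forall w m, cderiv h w m -> cderiv k w (m + - l)%C).
  { intros w m Hm. apply cderiv_plus; [exact Hm | apply cderiv_affine]. }
  assert (Hk : forall w, Cmod (w - z) <= exp s -> exists m, cderiv k w m).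
  { intros w Hw. destruct (Hh w Hw) as [m Hm]. eexists. apply Dk, Hm. }
  assert (Z : circle_integral k z s = 0).
  { apply (circle_integral_flat k z (exp s) Hk s); [lra | | unfold k; ring].
    replace (RtoC 0) with (l + - l)%C by ring. apply Dk, Hl. }
  apply (is_RInt_unique (V := C_R_CompleteNormedModule)).
  pose proof (RInt_correct (V := C_R_CompleteNormedModule) _ _ _
    (ex_circle_integral k z (exp s) Hk s (Rle_refl _))) as I1.
  fold (circle_integral k z s) in I1. rewrite Z in I1.
  pose proof (is_CRInt_Cmult (h z) _ _ _ _ (is_CRInt_circle_inverse s)) as I2.
  pose proof (is_RInt_const (V := C_R_NormedModule) 0 (2 * PI) l) as I3.
  pose proof (is_RInt_plus (V := C_R_NormedModule) _ _ _ _ _ _ I1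
    (is_RInt_plus (V := C_R_NormedModule) _ _ _ _ _ _ I2 I3)) as I.
  match type of I with is_RInt _ _ _ ?v => replace (RtoC (2 * PI) * l)%C with v end.
  - eapply is_RInt_ext; [| exact I]. intros t _.
    change (k (z + cexp (s, t)) * cexp (- (s, t)) + (h z * cexp (- (s, t)) + l) =
      h (z + cexp (s, t)) * cexp (- (s, t)))%C.
    unfold k. replace (z + cexp (s, t) - z)%C with (cexp (s, t)) by ring.
    assert (E : (cexp (s, t) * cexp (- (s, t)) = 1)%C).
    { rewrite <- cexp_plus, Cplus_opp_r. apply cexp_0. }
    transitivity (h (z + cexp (s, t)) * cexp (- (s, t)) +
      l * (1 - cexp (s, t) * cexp (- (s, t))))%C; [ring | rewrite E; ring].
  - rewrite scal_R_Cmult, Rminus_0_r.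
    change (0 + (h z * 0 + RtoC (2 * PI) * l) = RtoC (2 * PI) * l)%C. ring.
Qed.

Lemma cauchy_estimate (h : C -> C) (z l : C) (r M : R) :
  0 < r -> (forall w, Cmod (w - z) <= r -> exists m, cderiv h w m) ->
  (forall w, Cmod (w - z) <= r -> Cmod (h w) <= M) -> cderiv h z l ->
  Cmod l <= M / r.
Proof.
  intros Hr Hh HM Hl. pose proof PI_RGT_0.
  rewrite <- (exp_ln r Hr) in Hh.
  assert (C1 := cauchy_derivative_formula h z l (ln r) Hh Hl).
  assert (B : Cmod (circle_integral h z (ln r)) <= (2 * PI - 0) * (M / r)).
  { apply Cmod_RInt_le; [lra | apply (ex_circle_integral h z (exp (ln r)) Hh), Rle_refl |].
    intros t _. rewrite Cmod_mult, Cmod_cexp. simpl fst.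
    rewrite exp_Ropp, exp_ln by exact Hr.
    apply Rmult_le_compat_r; [left; apply Rinv_0_lt_compat, Hr |].
    apply HM. replace (z + cexp (ln r, t) - z)%C with (cexp (ln r, t)) by ring.
    rewrite Cmod_cexp. simpl fst. rewrite exp_ln by exact Hr. lra. }
  rewrite C1, Cmod_mult, Cmod_R, Rabs_pos_eq in B by lra.
  apply Rmult_le_reg_l with (2 * PI); lra.
Qed.

(** * Mean value inequalities and the second-order Taylor remainder *)

Lemma Rabs_increment_le (f : R -> R) (M : R) :
  (forall t, 0 <= t <= 1 -> exists l, is_derive f t l /\ Rabs l <= M) ->
  Rabs (f 1 - f 0) <= M.
Proof.
  intros H.
  destruct (MVT_gen f 0 1 (Derive f)) as [c [Hc E]].
  - intros t Ht. rewrite Rmin_left, Rmax_right in Ht by lra.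
    destruct (H t ltac:(lra)) as [l [Hl _]]. apply Derive_correct. exists l; exact Hl.
  - intros t Ht. rewrite Rmin_left, Rmax_right in Ht by lra.
    destruct (H t ltac:(lra)) as [l [Hl _]].
    apply continuity_pt_filterlim, (ex_derive_continuous f t). exists l; exact Hl.
  - rewrite Rmin_left, Rmax_right in Hc by lra.
    destruct (H c Hc) as [l [Hl HM]]. rewrite E, (is_derive_unique _ _ _ Hl).
    rewrite Rminus_0_r, Rmult_1_r. exact HM.
Qed.

Lemma is_derive_C_elim (f : R -> C) (t : R) (l : C) :
  is_derive (V := C_R_NormedModule) f t l ->
  is_derive (fun s => fst (f s)) t (fst l) /\ is_derive (fun s => snd (f s)) t (snd l).
Proof.
  intros [_ H].
  split; (split; [apply is_linear_scal_l |]); intros t' Ht' eps;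
    (assert (E : t = t')
       by exact (is_filter_lim_locally_unique (V := R_NormedModule) t t' Ht'));
    subst t'; generalize (H t Ht' eps); apply filter_imp; intros s Hs;
    rewrite Cmod_norm_R in Hs; (eapply Rle_trans; [| exact Hs]).
  - apply (Rabs_fst_le_Cmod (minus (minus (f s) (f t)) (scal (minus s t) l))).
  - apply (Rabs_snd_le_Cmod (minus (minus (f s) (f t)) (scal (minus s t) l))).
Qed.

(* The mean value theorem is applied to the real and the imaginary part: hence the factor 2. *)
Lemma Cmod_increment_le (h : C -> C) (z w : C) (M : R) :
  (forall t : R, 0 <= t <= 1 -> exists l, cderiv h (z + t * (w - z))%C l /\ Cmod l <= M) ->
  Cmod (h w - h z) <= 2 * (M * Cmod (w - z)).
Proof.
  intros H.
  set (f := fun t : R => h (z + t * (w - z))%C).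
  assert (D : forall t, 0 <= t <= 1 -> exists l,
    is_derive (V := C_R_NormedModule) f t l /\ Cmod l <= M * Cmod (w - z)).
  { intros t Ht. destruct (H t Ht) as [l [Hl HM]].
    exists ((w - z) * l)%C. split; [apply is_derive_C_line, Hl |].
    rewrite Cmod_mult, Rmult_comm.
    apply Rmult_le_compat_r; [apply Cmod_ge_0 | exact HM]. }
  assert (A1 : Rabs (fst (f 1) - fst (f 0)) <= M * Cmod (w - z)).
  { apply (Rabs_increment_le (fun t => fst (f t))). intros t Ht.
    destruct (D t Ht) as [l [Hl HM]]. exists (fst l).
    split; [apply is_derive_C_elim, Hl |].
    eapply Rle_trans; [apply Rabs_fst_le_Cmod | exact HM]. }
  assert (A2 : Rabs (snd (f 1) - snd (f 0)) <= M * Cmod (w - z)).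
  { apply (Rabs_increment_le (fun t => snd (f t))). intros t Ht.
    destruct (D t Ht) as [l [Hl HM]]. exists (snd l).
    split; [apply is_derive_C_elim, Hl |].
    eapply Rle_trans; [apply Rabs_snd_le_Cmod | exact HM]. }
  replace (h w) with (f 1) by (unfold f; f_equal; ring).
  replace (h z) with (f 0) by (unfold f; f_equal; ring).
  eapply Rle_trans; [apply Cmod_le_abs |].
  unfold Rminus in A1, A2. simpl. lra.
Qed.

Lemma Cmod_between (z0 z w : C) (r t : R) :
  0 <= t <= 1 -> Cmod (z - z0) < r -> Cmod (w - z0) < r ->
  Cmod (z + t * (w - z) - z0) < r.
Proof.
  intros Ht Hz Hw.
  replace (z + t * (w - z) - z0)%C with (RtoC (1 - t) * (z - z0) + RtoC t * (w - z0))%C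
    by (rewrite RtoC_minus; ring).
  eapply Rle_lt_trans; [apply Cmod_triangle |].
  rewrite !Cmod_mult, !Cmod_R, !Rabs_pos_eq by lra.
  (* One of the two weights is at least 1/2, which keeps the inequality strict. *)
  destruct (Rle_lt_dec t (1 / 2)); nra.
Qed.

(* [h'] is estimated on the ball of radius [2 r]; the variation of [h'] on the ball of radius [r]
   is estimated through the derivative of [v |-> h (v + (u - z0)) - h v] at [z0]. *)
Lemma taylor_remainder_le (h : C -> C) (z0 l : C) (r M : R) :
  0 < r -> (forall w, Cmod (w - z0) < 3 * r -> exists m, cderiv h w m) ->
  (forall w, Cmod (w - z0) < 3 * r -> Cmod (h w) <= M) -> cderiv h z0 l ->
  forall w, Cmod (w - z0) < r ->
    Cmod (h w - h z0 - l * (w - z0)) <= 4 * M / (r * r) * (Cmod (w - z0) * Cmod (w - z0)).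
Proof.
  intros Hr Hh HM Hl w Hw.
  assert (D2 : forall u m, Cmod (u - z0) < 2 * r -> cderiv h u m -> Cmod m <= M / r).
  { intros u m Hu Hm.
    assert (T : forall v, Cmod (v - u) <= r -> Cmod (v - z0) < 3 * r).
    { intros v Hv. replace (v - z0)%C with ((v - u) + (u - z0))%C by ring.
      eapply Rle_lt_trans; [apply Cmod_triangle | lra]. }
    apply (cauchy_estimate h u m r M Hr); try assumption; intros v Hv.
    - apply Hh, T, Hv.
    - apply HM, T, Hv. }
  assert (Lip : forall u v, Cmod (u - z0) < 2 * r -> Cmod (v - z0) < 2 * r ->
    Cmod (h v - h u) <= 2 * (M / r * Cmod (v - u))).
  { intros u v Hu Hv. apply Cmod_increment_le. intros t Ht.
    pose proof (Cmod_between z0 u v (2 * r) t Ht Hu Hv) as B.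
    destruct (Hh (u + t * (v - u))%C ltac:(lra)) as [m Hm].
    exists m. split; [exact Hm | apply (D2 _ _ B Hm)]. }
  assert (M0 : 0 <= M).
  { eapply Rle_trans; [apply Cmod_ge_0 | apply (HM z0)].
    replace (z0 - z0)%C with (RtoC 0) by ring. rewrite Cmod_0. lra. }
  assert (DL : forall u m, Cmod (u - z0) < r -> cderiv h u m ->
    Cmod (m - l) <= 2 * (M / r * Cmod (u - z0)) / r).
  { intros u m Hu Hm.
    (* At this stage h'' is not known to exist; the Cauchy estimate for this difference of
       translates, which is small by [Lip], bounds m - l directly. *)
    set (g := fun v => (h (v + (u - z0)) + (- (1)) * h v)%C).
    assert (T : forall v, Cmod (v - z0) <= r -> Cmod (v + (u - z0) - z0) < 2 * r).
    { intros v Hv. replace (v + (u - z0) - z0)%C with ((v - z0) + (u - z0))%C by ring.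
      eapply Rle_lt_trans; [apply Cmod_triangle | lra]. }
    assert (Dg : forall v m1 m2, cderiv h (v + (u - z0))%C m1 -> cderiv h v m2 ->
      cderiv g v (m1 - m2)%C).
    { intros v m1 m2 H1 H2. unfold g.
      eapply cderiv_ext; [reflexivity | | apply cderiv_plus].
      2: { apply (cderiv_comp h (fun v => v + (u - z0))%C v m1 1).
           - exact H1.
           - eapply cderiv_ext; [| | apply (cderiv_plus _ _ v _ _ (cderiv_id v)
               (cderiv_const (u - z0)%C v))]; [reflexivity | ring]. }
      2: { apply cderiv_scal, H2. }
      ring. }
    apply (cauchy_estimate g z0 (m - l)%C r); try assumption.
    - intros v Hv. destruct (Hh (v + (u - z0))%C) as [m1 H1].
      { specialize (T v Hv). lra. }
      destruct (Hh v ltac:(lra)) as [m2 H2]. eexists. apply (Dg v m1 m2 H1 H2).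
    - intros v Hv. unfold g.
      replace (h (v + (u - z0)) + - (1) * h v)%C with (h (v + (u - z0)) - h v)%C by ring.
      eapply Rle_trans; [apply Lip; [lra | apply T, Hv] |].
      right. do 3 f_equal. ring.
    - apply Dg; [| exact Hl]. replace (z0 + (u - z0))%C with u by ring. exact Hm. }
  set (k := fun v => (h v + (- h z0 + (- l) * (v - z0)))%C).
  assert (Z0 : Cmod (z0 - z0) = 0).
  { replace (z0 - z0)%C with (RtoC 0) by ring. apply Cmod_0. }
  (* The final 4 M / r^2 collects two Cauchy estimates (1 / r each) and two uses of
     [Cmod_increment_le] (2 each). *)
  assert (K : Cmod (k w - k z0) <= 2 * ((2 * (M / r * Cmod (w - z0)) / r) * Cmod (w - z0))).
  { apply Cmod_increment_le. intros t Ht.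
    pose proof (Cmod_between z0 z0 w r t Ht ltac:(lra) Hw) as B.
    destruct (Hh (z0 + t * (w - z0))%C ltac:(lra)) as [m Hm].
    exists (m + - l)%C. split.
    - apply cderiv_plus; [exact Hm | apply cderiv_affine].
    - change (m + - l)%C with (m - l)%C. eapply Rle_trans; [apply (DL _ _ B Hm) |].
      unfold Rdiv. apply Rmult_le_compat_r; [left; apply Rinv_0_lt_compat, Hr |].
      apply Rmult_le_compat_l; [lra |].
      apply Rmult_le_compat_l;
        [apply Rmult_le_pos; [exact M0 | left; apply Rinv_0_lt_compat, Hr] |].
      replace (z0 + t * (w - z0) - z0)%C with (RtoC t * (w - z0))%C by ring.
      rewrite Cmod_mult, Cmod_R, Rabs_pos_eq by lra.
      pose proof (Cmod_ge_0 (w - z0)). nra. }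
  replace (h w - h z0 - l * (w - z0))%C with (k w - k z0)%C by (unfold k; ring).
  eapply Rle_trans; [exact K |]. right. field. lra.
Qed.

(** * Integrals over a half-line *)

Definition halfline (f : R -> C) (v : C) : Prop :=
  forall eps, 0 < eps -> exists B, forall b, B <= b -> Cmod (CRInt f 0 b - v) < eps.

(** The rate is normalized to 1, so the integral of the bound over the half-line is [K] itself. *)
Definition decaying (f : R -> C) (K : R) : Prop :=
  (forall y, 0 <= y -> continuous (U := C_UniformSpace) f y) /\
  (forall y, 0 <= y -> Cmod (f y) <= K * exp (- y)).

Lemma decaying_ex_CRInt (f : R -> C) (K a b : R) :
  decaying f K -> 0 <= a <= b -> ex_CRInt f a b.
Proof.
  intros [Hc _] Hab. apply ex_CRInt_cont; [lra |]. intros t Ht. apply Hc. lra.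
Qed.

Lemma decaying_nonneg (f : R -> C) (K : R) : decaying f K -> 0 <= K.
Proof.
  intros [_ H]. specialize (H 0 (Rle_refl 0)).
  rewrite Ropp_0, exp_0 in H. pose proof (Cmod_ge_0 (f 0)). lra.
Qed.

Lemma decaying_tail (f : R -> C) (K a b : R) :
  decaying f K -> 0 <= a <= b -> Cmod (CRInt f a b) <= K * exp (- a).
Proof.
  intros Hf Hab.
  assert (I : is_RInt (fun y => K * exp (- y)) a b (- K * exp (- b) - - K * exp (- a))).
  { apply (is_RInt_derive (fun y => - K * exp (- y)) (fun y => K * exp (- y))).
    - intros t _. auto_derive; auto; ring.
    - intros t _. apply (ex_derive_continuous (fun y => K * exp (- y))). auto_derive; auto. }
  rewrite <- Cmod_norm_R.
  eapply Rle_trans.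
  - apply (norm_RInt_le (V := C_R_NormedModule) f (fun y => K * exp (- y)) a b _ _ (proj2 Hab));
      [| | exact I].
    + intros y Hy. rewrite Cmod_norm_R. apply Hf. lra.
    + apply (RInt_correct (V := C_R_CompleteNormedModule)).
      apply (decaying_ex_CRInt f K _ _ Hf Hab).
  - pose proof (decaying_nonneg _ _ Hf). pose proof (exp_pos (- b)). nra.
Qed.

Lemma decaying_CRInt_diff (f : R -> C) (K a b : R) :
  decaying f K -> 0 <= a <= b -> Cmod (CRInt f 0 b - CRInt f 0 a) <= K * exp (- a).
Proof.
  intros Hf Hab.
  assert (E : CRInt f 0 b = (CRInt f 0 a + CRInt f a b)%C).
  { symmetry. apply (RInt_Chasles (V := C_R_CompleteNormedModule));
      apply (decaying_ex_CRInt f K); try assumption; lra. }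
  rewrite E. replace (CRInt f 0 a + CRInt f a b - CRInt f 0 a)%C with (CRInt f a b) by Cring.
  apply decaying_tail; assumption.
Qed.

(** Square e^{y/2} >= 1 + y/2. This absorbs the outer arc in the rotation and the factor y^2 of the
    regularization error. *)
Lemma exp_sq_lower (y : R) : 0 <= y -> y * y <= 4 * exp y.
Proof.
  intros Hy. replace (exp y) with (exp (y / 2) * exp (y / 2))
    by (rewrite <- exp_plus; f_equal; field).
  pose proof (exp_ineq1_le (y / 2)). nra.
Qed.

Lemma exp_neg_small (K eps : R) :
  0 <= K -> 0 < eps -> exists B, 0 < B /\ forall b, B <= b -> K * exp (- b) < eps.
Proof.
  (* This threshold comes from e^b >= 1 + b. *)
  intros HK He. exists (1 + K / eps).
  assert (H0 : 0 <= K / eps)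
    by (apply Rmult_le_pos; [exact HK | left; apply Rinv_0_lt_compat, He]).
  split; [lra |]. intros b Hb.
  rewrite exp_Ropp. pose proof (exp_ineq1_le b) as H1.
  apply Rmult_lt_reg_r with (exp b); [apply exp_pos |].
  rewrite Rmult_assoc, Rinv_l, Rmult_1_r by (pose proof (exp_pos b); lra).
  assert (H2 : K = K / eps * eps) by (field; lra).
  nra.
Qed.

Lemma decaying_halfline (f : R -> C) (K : R) : decaying f K -> exists v, halfline f v.
Proof.
  intros Hf. pose proof (decaying_nonneg _ _ Hf) as HK.
  destruct (proj1 (filterlim_locally_cauchy (U := C_CompleteNormedModule)
    (F := Rbar_locally p_infty) (fun b => CRInt f 0 b))) as [v Hv].
  - intros eps. destruct (exp_neg_small K eps HK (cond_pos eps)) as [B [HB0 HB]].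
    exists (fun b => B < b). split; [exists B; auto |].
    assert (W : forall u w, B < u -> u <= w ->
      Cmod (CRInt f 0 w - CRInt f 0 u) < eps).
    { intros u w Hu Huw. eapply Rle_lt_trans.
      - apply (decaying_CRInt_diff f K); [exact Hf | lra].
      - apply HB. lra. }
    intros u w Hu Hw. apply C_ball_of_Cmod.
    destruct (Rle_lt_dec u w) as [L | L]; [apply W; assumption |].
    rewrite Cmod_minus_sym. apply W; lra.
  - exists v. intros eps He. assert (He2 : 0 < eps / 2) by lra.
    destruct (proj1 (filterlim_locally (U := C_UniformSpace) _ v) Hv (mkposreal _ He2))
      as [B HB].
    exists (B + 1). intros b Hb. apply Cmod_of_C_ball; [exact He |].
    apply HB. lra.
Qed.

Lemma halfline_Cmod_le (f : R -> C) (K : R) (v : C) :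
  decaying f K -> halfline f v -> Cmod v <= K.
Proof.
  intros Hf Hv. apply le_epsilon. intros e He.
  destruct (Hv e He) as [B HB].
  specialize (HB (Rmax 0 B) (Rmax_r _ _)).
  pose proof (decaying_tail f K 0 (Rmax 0 B) Hf ltac:(split; [lra | apply Rmax_l])) as T.
  rewrite Ropp_0, exp_0 in T.
  replace v with (CRInt f 0 (Rmax 0 B) - (CRInt f 0 (Rmax 0 B) - v))%C by ring.
  eapply Rle_trans; [apply Cmod_minus_le |]. lra.
Qed.

Lemma halfline_Cmult (c : C) (f : R -> C) (K : R) (v : C) :
  decaying f K -> halfline f v -> halfline (fun y => c * f y)%C (c * v)%C.
Proof.
  intros Hf Hv eps He. pose proof (Cmod_ge_0 c) as Hc.
  assert (He' : 0 < eps / (1 + Cmod c)) by (apply Rdiv_lt_0_compat; lra).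
  destruct (Hv _ He') as [B HB]. exists (Rmax 0 B). intros b Hb.
  pose proof (Rmax_l 0 B). pose proof (Rmax_r 0 B).
  rewrite CRInt_Cmult by (apply (decaying_ex_CRInt f K); [exact Hf | lra]).
  replace (c * CRInt f 0 b - c * v)%C with (c * (CRInt f 0 b - v))%C by Cring.
  rewrite Cmod_mult. specialize (HB b ltac:(lra)).
  pose proof (Cmod_ge_0 (CRInt f 0 b - v)).
  replace eps with ((1 + Cmod c) * (eps / (1 + Cmod c))) by (field; lra). nra.
Qed.

Lemma halfline_minus (f g : R -> C) (K L : R) (v w : C) :
  decaying f K -> decaying g L -> halfline f v -> halfline g w ->
  halfline (fun y => f y - g y)%C (v - w)%C.
Proof.
  intros Hf Hg Hv Hw eps He. assert (He2 : 0 < eps / 2) by lra.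
  destruct (Hv _ He2) as [B1 H1]. destruct (Hw _ He2) as [B2 H2].
  exists (Rmax 0 (Rmax B1 B2)). intros b Hb.
  pose proof (Rmax_l 0 (Rmax B1 B2)). pose proof (Rmax_r 0 (Rmax B1 B2)).
  pose proof (Rmax_l B1 B2). pose proof (Rmax_r B1 B2).
  assert (E : CRInt (fun y => f y - g y)%C 0 b = (CRInt f 0 b - CRInt g 0 b)%C).
  { apply (RInt_minus (V := C_R_CompleteNormedModule));
      [apply (decaying_ex_CRInt f K) | apply (decaying_ex_CRInt g L)]; try assumption; lra. }
  rewrite E.
  replace (CRInt f 0 b - CRInt g 0 b - (v - w))%C
    with ((CRInt f 0 b - v) - (CRInt g 0 b - w))%C by Cring.
  eapply Rle_lt_trans; [apply Cmod_minus_le |].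
  specialize (H1 b ltac:(lra)). specialize (H2 b ltac:(lra)). lra.
Qed.

Lemma decaying_Cmult (c : C) (f : R -> C) (K : R) :
  decaying f K -> decaying (fun y => c * f y)%C (Cmod c * K).
Proof.
  intros [H1 H2]. split; intros y Hy.
  - apply continuous_Cmult; [apply continuous_const | apply H1, Hy].
  - rewrite Cmod_mult, Rmult_assoc.
    apply Rmult_le_compat_l; [apply Cmod_ge_0 | apply H2, Hy].
Qed.

Lemma decaying_minus (f g : R -> C) (K L : R) :
  decaying f K -> decaying g L -> decaying (fun y => f y - g y)%C (K + L).
Proof.
  intros [H1 H2] [H3 H4]. split; intros y Hy.
  - apply (continuous_minus (V := C_R_NormedModule)); [apply H1, Hy | apply H3, Hy].
  - eapply Rle_trans; [apply Cmod_minus_le |].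
    specialize (H2 y Hy). specialize (H4 y Hy). lra.
Qed.

Lemma halfline_ext (f g : R -> C) (v : C) :
  (forall y, 0 <= y -> f y = g y) -> halfline f v -> halfline g v.
Proof.
  intros E H eps He. destruct (H eps He) as [B HB]. exists (Rmax 0 B). intros b Hb.
  pose proof (Rmax_l 0 B). pose proof (Rmax_r 0 B).
  rewrite <- (RInt_ext (V := C_R_CompleteNormedModule) f g); [apply HB; lra |].
  intros y Hy. rewrite Rmin_left in Hy by lra. apply E. lra.
Qed.

(** Logarithmic coordinates do not reach the origin, so the rotation takes place between the radii
    1/b and b; arcs and initial segments vanish together as b grows. *)
Lemma halfline_rotation (f : C -> C) (beta K : R) (v w : C) :
  0 <= beta ->
  (forall r theta, 0 <= r -> 0 <= theta <= beta ->
     exists l, cderiv f (r * cexp (0%R, theta))%C l) ->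
  (forall r theta, 0 <= r -> 0 <= theta <= beta ->
     Cmod (f (r * cexp (0%R, theta))%C) <= K * exp (- r)) ->
  halfline (fun y : R => f y) v ->
  halfline (fun y : R => cexp (0%R, beta) * f (y * cexp (0%R, beta)))%C w ->
  v = w.
Proof.
  intros Hb Hd HK Hv Hw.
  assert (Dec : forall theta, 0 <= theta <= beta ->
    decaying (fun y : R => cexp (0%R, theta) * f (y * cexp (0%R, theta)))%C K).
  { intros theta Ht. split; intros y Hy.
    - destruct (Hd y theta Hy Ht) as [l Hl].
      apply continuous_Cmult; [apply continuous_const | apply continuous_on_ray with l, Hl].
    - rewrite Cmod_mult, Cmod_cis, Rmult_1_l. apply HK; assumption. }
  assert (C0 : cexp (0%R, 0%R) = RtoC 1) by exact cexp_0.
  assert (E0 : forall y : R, (cexp (0%R, 0%R) * f (y * cexp (0%R, 0%R)))%C = f y).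
  { intros y. rewrite C0, Cmult_1_l, Cmult_1_r. reflexivity. }
  assert (Dec0 : decaying (fun y : R => f y) K).
  { destruct (Dec 0 ltac:(lra)) as [D1 D2]. split; intros y Hy.
    - apply continuous_ext with (2 := D1 y Hy). intros t. apply E0.
    - rewrite <- E0. apply D2, Hy. }
  specialize (Dec beta ltac:(lra)).
  set (g := fun y : R => (cexp (0%R, beta) * f (y * cexp (0%R, beta)))%C) in *.
  pose proof (decaying_nonneg _ _ Dec) as K0.
  (* Two initial segments up to 1/b give 2 K/b, the inner arc beta K/b, and the outer arc beta b K
     e^{-b} <= 4 beta K/b. *)
  assert (Bound : forall b, 1 <= b ->
    Cmod (CRInt (fun y : R => f y) 0 b - CRInt g 0 b) <= (2 + 5 * beta) * K * / b).
  { intros b Hb1.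
    assert (Hib : 0 < / b <= 1).
    { split; [apply Rinv_0_lt_compat; lra |].
      rewrite <- Rinv_1. apply Rinv_le_contravar; lra. }
    assert (Ch : forall h L, decaying h L ->
      CRInt h 0 b = (CRInt h 0 (/ b)%R + CRInt h (/ b)%R b)%C).
    { intros h L Hh. symmetry. apply (RInt_Chasles (V := C_R_CompleteNormedModule));
        apply (decaying_ex_CRInt h L); try assumption; lra. }
    assert (Sm : forall h, decaying h K -> Cmod (CRInt h 0 (/ b)) <= K * / b).
    { intros h Hh. replace (K * / b) with ((/ b - 0) * K) by ring.
      apply Cmod_RInt_le; [lra | apply (decaying_ex_CRInt h K); [assumption | lra] |].
      intros y Hy. eapply Rle_trans; [apply Hh; lra |].
      rewrite <- (Rmult_1_r K) at 2. apply Rmult_le_compat_l; [exact K0 |].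
      rewrite <- exp_0. apply exp_le. lra. }
    rewrite (Ch _ _ Dec0), (Ch _ _ Dec).
    assert (R1 := Cmod_sector_rotation_le f beta (/ b) b K (K * exp (- b)) Hb ltac:(lra)).
    specialize (R1 ltac:(intros; apply Hd; lra)).
    assert (R2 : forall theta, 0 <= theta <= beta ->
      Cmod (f ((/ b)%R * cexp (0%R, theta))%C) <= K).
    { intros theta Ht. eapply Rle_trans; [apply HK; lra |].
      rewrite <- (Rmult_1_r K) at 2. apply Rmult_le_compat_l; [exact K0 |].
      rewrite <- exp_0. apply exp_le. lra. }
    specialize (R1 R2 ltac:(intros; apply HK; lra)). fold g in R1.
    pose proof (Sm _ Dec0) as S1. pose proof (Sm _ Dec) as S2.
    assert (Eb : b * (K * exp (- b)) <= K * (4 * / b)).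
    { rewrite exp_Ropp. pose proof (exp_sq_lower b ltac:(lra)). pose proof (exp_pos b).
      replace (b * (K * / exp b)) with (K * (b * / exp b)) by ring.
      apply Rmult_le_compat_l; [exact K0 |].
      apply Rmult_le_reg_r with (b * exp b); [nra |].
      replace (b * / exp b * (b * exp b)) with (b * b) by (field; lra).
      replace (4 * / b * (b * exp b)) with (4 * exp b) by (field; lra). assumption. }
    set (p1 := CRInt (fun y : R => f y) 0 (/ b)) in *. set (p2 := CRInt g 0 (/ b)) in *.
    set (q1 := CRInt (fun y : R => f y) (/ b) b) in *. set (q2 := CRInt g (/ b) b) in *.
    replace (p1 + q1 - (p2 + q2))%C with ((p1 - p2) + (q1 - q2))%C by Cring.
    eapply Rle_trans; [apply Cmod_triangle |].
    pose proof (Cmod_minus_le p1 p2). nra. }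
  apply Ceq_minus, Cmod_eq_0, Rle_antisym; [| apply Cmod_ge_0].
  apply le_epsilon. intros e He. rewrite Rplus_0_l.
  assert (He3 : 0 < e / 3) by lra.
  destruct (Hv _ He3) as [B1 H1]. destruct (Hw _ He3) as [B2 H2].
  set (Q := (2 + 5 * beta) * K). assert (HQ : 0 <= Q) by (unfold Q; nra).
  set (b := Rmax (Rmax B1 B2) (1 + Q / (e / 3))).
  assert (G1 : B1 <= b) by (eapply Rle_trans; [apply (Rmax_l B1 B2) | apply Rmax_l]).
  assert (G2 : B2 <= b) by (eapply Rle_trans; [apply (Rmax_r B1 B2) | apply Rmax_l]).
  assert (G3 : 1 + Q / (e / 3) <= b) by apply Rmax_r.
  assert (HQe : 0 <= Q / (e / 3))
    by (apply Rmult_le_pos; [exact HQ | left; apply Rinv_0_lt_compat, He3]).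
  specialize (H1 b G1). specialize (H2 b G2). specialize (Bound b ltac:(lra)). fold Q in Bound.
  assert (QB : Q * / b <= e / 3).
  { apply Rmult_le_reg_r with b; [lra |]. rewrite Rmult_assoc, Rinv_l, Rmult_1_r by lra.
    assert (Q = Q / (e / 3) * (e / 3)) by (field; lra). nra. }
  set (I1 := CRInt (fun y : R => f y) 0 b) in *. set (I2 := CRInt g 0 b) in *.
  replace (v - w)%C with ((I1 - I2) - (I1 - v) + (I2 - w))%C by Cring.
  eapply Rle_trans; [apply Cmod_triangle |].
  eapply Rle_trans; [apply Rplus_le_compat_r, Cmod_minus_le |]. lra.
Qed.

Lemma is_RInt_gen_of_halflines (g : R -> C) (v w : C) :
  (forall y, continuous (U := C_UniformSpace) g y) ->
  halfline g v -> halfline (fun y => g (- y)) w ->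
  is_RInt_gen (V := C_R_NormedModule) g (Rbar_locally m_infty) (Rbar_locally p_infty) (v + w)%C.
Proof.
  intros Hc Hv Hw.
  assert (Ex : forall a b, ex_CRInt g a b).
  { intros a b. apply (ex_RInt_continuous (V := C_R_CompleteNormedModule)). intros; apply Hc. }
  apply filterlimi_locally. intros eps.
  assert (He : 0 < eps / 2) by (pose proof (cond_pos eps); lra).
  destruct (Hv _ He) as [B1 H1]. destruct (Hw _ He) as [B2 H2].
  apply Filter_prod with (fun a => a < - B2) (fun b => B1 < b).
  - exists (- B2). auto.
  - exists B1. auto.
  - intros a b Ha Hb. simpl. exists (CRInt g a b). split.
    + apply (RInt_correct (V := C_R_CompleteNormedModule)), Ex.
    + apply C_ball_of_Cmod.
      assert (E1 : CRInt g a b = (CRInt g 0 b - CRInt g 0 a)%C).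
      { assert (E : (CRInt g 0 a + CRInt g a b)%C = CRInt g 0 b)
          by (apply (RInt_Chasles (V := C_R_CompleteNormedModule)); apply Ex).
        rewrite <- E. Cring. }
      assert (E2 : CRInt g 0 a = (- CRInt (fun y => g (- y)%R) 0 (- a)%R)%C).
      { apply (is_RInt_unique (V := C_R_CompleteNormedModule)).
        assert (I : is_CRInt (fun y => g (- y)) (- 0) (- a) (CRInt (fun y => g (- y)) 0 (- a))).
        { rewrite Ropp_0. apply (RInt_correct (V := C_R_CompleteNormedModule)).
          apply (ex_RInt_continuous (V := C_R_CompleteNormedModule)). intros z _.
          apply (continuous_comp (V := R_UniformSpace) (W := C_UniformSpace) Ropp g); [| apply Hc].
          apply (continuous_opp (V := R_NormedModule)), continuous_id. }
        apply (is_RInt_comp_opp (V := C_R_NormedModule)) in I.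
        apply (is_RInt_opp (V := C_R_NormedModule)) in I.
        eapply is_RInt_ext; [| exact I]. intros y _. cbv beta.
        rewrite Ropp_involutive. apply (opp_opp (G := C_R_NormedModule)). }
      rewrite E1, E2.
      replace (CRInt g 0 b - - CRInt (fun y => g (- y)%R) 0 (- a)%R - (v + w))%C
        with ((CRInt g 0 b - v) + (CRInt (fun y => g (- y)%R) 0 (- a)%R - w))%C by Cring.
      eapply Rle_lt_trans; [apply Cmod_triangle |].
      specialize (H1 b ltac:(lra)). specialize (H2 (- a) ltac:(lra)). lra.
Qed.

(* The difference quotients of [J] at [k0] are Cauchy because those of [h _ y] differ by at most a
   multiple of [exp (- y)] times the increments; the integrability of the derivative of [h _ y]
   in the parameter is never needed. *)
Lemma halfline_cderiv (h : C -> R -> C) (J : C -> C) (k0 : C) (r M : R) :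
  0 < r ->
  (forall k y, Cmod (k - k0) < 3 * r -> 0 <= y -> exists m, cderiv (fun k => h k y) k m) ->
  (forall k, Cmod (k - k0) < 3 * r -> decaying (h k) M) ->
  (forall k, Cmod (k - k0) < 3 * r -> halfline (h k) (J k)) ->
  exists l, cderiv J k0 l.
Proof.
  intros Hr Hd Hdec HJ.
  assert (Z0 : Cmod (k0 - k0) = 0).
  { replace (k0 - k0)%C with (RtoC 0) by Cring. apply Cmod_0. }
  assert (HM : 0 <= M) by (apply (decaying_nonneg (h k0)), Hdec; lra).
  set (Q := 4 * M / (r * r)).
  assert (HQ : 0 <= Q).
  { unfold Q. apply Rmult_le_pos; [lra | left; apply Rinv_0_lt_compat; nra]. }
  set (q := fun k => ((J k - J k0) / (k - k0))%C).
  assert (NZ : forall k, 0 < Cmod (k - k0) -> (k - k0)%C <> RtoC 0).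
  { intros k Hk E. rewrite E, Cmod_0 in Hk. lra. }
  assert (Qb : forall k k', 0 < Cmod (k - k0) < r -> 0 < Cmod (k' - k0) < r ->
    Cmod (q k - q k') <= Q * (Cmod (k - k0) + Cmod (k' - k0))).
  { intros k k' Hk Hk'.
    set (dq := fun k y => (/ (k - k0) * (h k y - h k0 y))%C).
    assert (Dq : forall k, 0 < Cmod (k - k0) < r ->
      exists L, decaying (dq k) L /\ halfline (dq k) (q k)).
    { intros u Hu. eexists. split.
      - apply decaying_Cmult, decaying_minus; apply Hdec; lra.
      - unfold q, Cdiv. rewrite Cmult_comm. eapply halfline_Cmult.
        + apply decaying_minus; apply Hdec; lra.
        + eapply halfline_minus; try (apply Hdec; lra); apply HJ; lra. }
    destruct (Dq k Hk) as [L [D1 D2]]. destruct (Dq k' Hk') as [L' [D1' D2']].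
    apply (halfline_Cmod_le (fun y => dq k y - dq k' y)%C); [| eapply halfline_minus; eassumption].
    split; [apply (decaying_minus _ _ _ _ D1 D1') |]. intros y Hy.
    (* This l depends on y, but it cancels from the difference of the two quotients. *)
    destruct (Hd k0 y ltac:(lra) Hy) as [l Hl].
    assert (T : forall u, 0 < Cmod (u - k0) < r ->
      Cmod (dq u y - l) <= Q * Cmod (u - k0) * exp (- y)).
    { intros u Hu.
      pose proof (taylor_remainder_le (fun k => h k y) k0 l r (M * exp (- y)) Hr
        (fun w Hw => Hd w y Hw Hy) (fun w Hw => proj2 (Hdec w Hw) y Hy) Hl u (proj2 Hu)) as T.
      cbv beta in T.
      replace (dq u y - l)%C with (/ (u - k0) * (h u y - h k0 y - l * (u - k0)))%C.
      2: { unfold dq. field. apply NZ, Hu. }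
      rewrite Cmod_mult, Cmod_inv by (apply NZ, Hu).
      apply Rmult_le_reg_l with (Cmod (u - k0)); [apply Hu |].
      rewrite <- Rmult_assoc, Rinv_r, Rmult_1_l by lra.
      eapply Rle_trans; [exact T |]. right. unfold Q. field. lra. }
    replace (dq k y - dq k' y)%C with ((dq k y - l) - (dq k' y - l))%C by Cring.
    eapply Rle_trans; [apply Cmod_minus_le |].
    pose proof (T k Hk). pose proof (T k' Hk'). lra. }
  assert (Real : forall t : R, 0 < t -> Cmod (k0 + t - k0) = t).
  { intros t Ht. replace (k0 + t - k0)%C with (RtoC t) by Cring.
    rewrite Cmod_R. apply Rabs_pos_eq. lra. }
  assert (Near : forall e, 0 < e -> at_right 0 (fun t => 0 < t < e)).
  { intros e He. exists (mkposreal e He). intros t Ht Ht0.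
    change (Rabs (t - 0) < e) in Ht. rewrite Rminus_0_r, Rabs_pos_eq in Ht; lra. }
  (* A limit along the positive real direction suffices: [Qb] compares quotients in any two
     directions and carries the limit over to all of them in [Ql]. *)
  destruct (proj1 (filterlim_locally_cauchy (U := C_CompleteNormedModule)
    (F := at_right 0) (fun t : R => q (k0 + t)%C))) as [l Hl].
  { intros eps.
    assert (Hq : 0 < Rmin r (eps / (2 * Q + 1))).
    { apply Rmin_pos; [exact Hr | apply Rdiv_lt_0_compat; [apply cond_pos | lra]]. }
    exists (fun t => 0 < t < Rmin r (eps / (2 * Q + 1))). split; [apply Near, Hq |].
    intros u w Hu Hw. apply C_ball_of_Cmod.
    assert (B : forall t, 0 < t < Rmin r (eps / (2 * Q + 1)) ->
      t < r /\ t * (2 * Q + 1) < eps).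
    { intros t Ht. pose proof (Rmin_l r (eps / (2 * Q + 1))).
      pose proof (Rmin_r r (eps / (2 * Q + 1))). split; [lra |].
      apply Rmult_lt_reg_r with (/ (2 * Q + 1)); [apply Rinv_0_lt_compat; lra |].
      rewrite Rmult_assoc, Rinv_r, Rmult_1_r by lra. unfold Rdiv in *. lra. }
    destruct (B u Hu), (B w Hw).
    eapply Rle_lt_trans; [apply Qb; rewrite !Real by lra; lra |].
    rewrite !Real by lra. nra. }
  exists l.
  assert (Ql : forall k, 0 < Cmod (k - k0) < r -> Cmod (q k - l) <= Q * Cmod (k - k0)).
  { intros k Hk. apply le_epsilon. intros e He.
    assert (He4 : 0 < e / 2 / 2) by lra.
    pose proof (proj1 (filterlim_locally (U := C_UniformSpace) _ l) Hl (mkposreal _ He4)) as F1.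
    assert (Hq : 0 < Rmin r (e / 2 / (Q + 1))).
    { apply Rmin_pos; [exact Hr | apply Rdiv_lt_0_compat; lra]. }
    destruct (filter_ex _ (filter_and _ _ F1 (Near _ Hq))) as [t [T1 T2]].
    apply Cmod_of_C_ball in T1; [| lra].
    pose proof (Rmin_l r (e / 2 / (Q + 1))). pose proof (Rmin_r r (e / 2 / (Q + 1))).
    assert (T3 : Q * t <= e / 2).
    { apply Rle_trans with ((Q + 1) * (e / 2 / (Q + 1))); [| right; field; lra].
      apply Rmult_le_compat; lra. }
    pose proof (Qb k (k0 + t)%C Hk ltac:(rewrite Real by lra; lra)) as B.
    rewrite Real in B by lra.
    replace (q k - l)%C with ((q k - q (k0 + t)) + (q (k0 + t) - l))%C by Cring.
    eapply Rle_trans; [apply Cmod_triangle |]. lra. }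
  intros eps He.
  exists (Rmin r (eps / (Q + 1))). split.
  { apply Rmin_pos; [exact Hr | apply Rdiv_lt_0_compat; lra]. }
  intros k Hk.
  destruct (Req_dec (Cmod (k - k0)) 0) as [E | N].
  - apply Cmod_eq_0, Ceq_minus in E. subst k.
    replace (J k0 - J k0 - l * (k0 - k0))%C with (RtoC 0) by Cring.
    rewrite Cmod_0, Z0. lra.
  - pose proof (Cmod_ge_0 (k - k0)).
    pose proof (Rmin_l r (eps / (Q + 1))). pose proof (Rmin_r r (eps / (Q + 1))).
    replace (J k - J k0 - l * (k - k0))%C with ((q k - l) * (k - k0))%C
      by (unfold q; field; apply NZ; lra).
    rewrite Cmod_mult. apply Rmult_le_compat_r; [lra |].
    eapply Rle_trans; [apply Ql; lra |].
    apply Rle_trans with ((Q + 1) * (eps / (Q + 1))); [| right; field; lra].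
    apply Rmult_le_compat; lra.
Qed.

(** * Gaussian regularization *)

(* Completing the square: [D r - s r^2 <= (D + n)^2 / (4 s) - n r]. *)
Lemma gaussian_le_exp (K D s n r : R) :
  0 <= K -> 0 < s ->
  K * exp (D * r - s * (r * r)) <= K * exp ((D + n) * (D + n) / (4 * s)) * exp (- (n * r)).
Proof.
  intros HK Hs. rewrite Rmult_assoc. apply Rmult_le_compat_l; [exact HK |].
  rewrite <- exp_plus. apply exp_le.
  assert (E : (D + n) * (D + n) / (4 * s) + - (n * r) - (D * r - s * (r * r)) =
    (D + n - 2 * s * r) * (D + n - 2 * s * r) / (4 * s)) by (field; lra).
  assert (0 <= (D + n - 2 * s * r) * (D + n - 2 * s * r) / (4 * s)).
  { apply Rmult_le_pos; [apply Rle_0_sqr | left; apply Rinv_0_lt_compat; lra]. }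
  lra.
Qed.

Lemma fst_polar_sq (r theta : R) :
  fst ((r * cexp (0%R, theta)) * (r * cexp (0%R, theta)))%C = r * r * cos (2 * theta).
Proof.
  unfold cexp, Cmult, RtoC; simpl. rewrite exp_0, cos_2a. ring.
Qed.

Lemma cderiv_gaussian (eps : R) (z : C) :
  exists l, cderiv (fun w => cexp (- RtoC eps * (w * w)))%C z l.
Proof.
  eexists. apply (cderiv_comp cexp (fun w => - RtoC eps * (w * w))%C); [apply cderiv_cexp |].
  apply cderiv_scal, cderiv_mult; apply cderiv_id.
Qed.

Section Regularization.
Variables (f : C -> C) (beta c s K D : R).
Hypothesis Hbeta : 0 <= beta.
Hypothesis Hc : 0 < c.
Hypothesis Hs : 0 < s.
Hypothesis HK : 0 <= K.
Hypothesis Hcos : forall theta, 0 <= theta <= beta -> c <= cos (2 * theta).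
Hypothesis Hdiff : forall r theta, 0 <= r -> 0 <= theta <= beta ->
  exists l, cderiv f (r * cexp (0%R, theta))%C l.
Hypothesis Hexp : forall r theta, 0 <= r -> 0 <= theta <= beta ->
  Cmod (f (r * cexp (0%R, theta))%C) <= K * exp (D * r).
Hypothesis Hgauss : forall r, 0 <= r ->
  Cmod (f (r * cexp (0%R, beta))%C) <= K * exp (D * r - s * (r * r)).

(** The factor in front is dz/dy on the ray. *)
Definition rotated (f : C -> C) (beta : R) : R -> C :=
  fun y => (cexp (0%R, beta) * f (y * cexp (0%R, beta)))%C.

Lemma continuous_rotated (y : R) :
  0 <= y -> continuous (U := C_UniformSpace) (rotated f beta) y.
Proof.
  intros Hy. destruct (Hdiff y beta Hy) as [l Hl]; [lra |].
  apply continuous_Cmult; [apply continuous_const | apply continuous_on_ray with l, Hl].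
Qed.

(** The rate n stays free because it is needed twice: n = 1 for convergence, n = 2 to leave room for
    the growing factor of the regularization error. *)
Lemma Cmod_rotated_le (n y : R) :
  0 <= y -> Cmod (rotated f beta y) <=
    K * exp ((D + n) * (D + n) / (4 * s)) * exp (- (n * y)).
Proof.
  intros Hy. unfold rotated. rewrite Cmod_mult, Cmod_cis, Rmult_1_l.
  eapply Rle_trans; [apply Hgauss, Hy | apply gaussian_le_exp; assumption].
Qed.

Lemma decaying_rotated :
  decaying (rotated f beta) (K * exp ((D + 1) * (D + 1) / (4 * s))).
Proof.
  split; intros y Hy; [apply continuous_rotated, Hy |].
  rewrite <- (Rmult_1_l y) at 2. apply Cmod_rotated_le, Hy.
Qed.

(** The regularized function decays on the whole closed sector, so its integral can be moved to the
    final ray. There it differs from the unregularized one by the factor e^u - 1 with Re u <= 0,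
    hence |e^u - 1| <= |u| = eps y^2, which is linear in eps. *)
Lemma gaussian_regularization (w : C) (eps : R) :
  halfline (rotated f beta) w -> 0 < eps ->
  exists v,
    halfline (fun y : R => cexp (- RtoC eps * (RtoC y * RtoC y)) * f y)%C v /\
    Cmod (v - w) <= 4 * (K * exp ((D + 2) * (D + 2) / (4 * s))) * eps.
Proof.
  intros Hw He.
  set (L := K * exp ((D + 2) * (D + 2) / (4 * s))).
  set (fe := fun z => (cexp (- RtoC eps * (z * z)) * f z)%C).
  assert (Hm : forall r theta : R,
    Cmod (cexp (- RtoC eps * ((r * cexp (0%R, theta)) * (r * cexp (0%R, theta))))) =
    exp (- eps * (r * r * cos (2 * theta)))).
  { intros r theta. rewrite Cmod_cexp. f_equal.
    rewrite <- fst_polar_sq. rewrite <- RtoC_opp. apply re_scal_l. }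
  assert (De : forall r theta, 0 <= r -> 0 <= theta <= beta ->
    exists l, cderiv fe (r * cexp (0%R, theta))%C l).
  { intros r theta Hr Ht. destruct (Hdiff r theta Hr Ht) as [l Hl].
    destruct (cderiv_gaussian eps (r * cexp (0%R, theta))%C) as [m Hm'].
    eexists. apply cderiv_mult; eassumption. }
  (* This constant blows up as eps tends to 0; it only justifies the rotation and does not enter the
     final estimate. *)
  set (Ke := K * exp ((D + 1) * (D + 1) / (4 * (eps * c)))).
  assert (Be : forall r theta, 0 <= r -> 0 <= theta <= beta ->
    Cmod (fe (r * cexp (0%R, theta))%C) <= Ke * exp (- r)).
  { intros r theta Hr Ht. unfold fe. rewrite Cmod_mult, Hm.
    apply Rle_trans with (K * exp (D * r - eps * c * (r * r))).
    - apply Rle_trans with (exp (- eps * (r * r * cos (2 * theta))) * (K * exp (D * r))).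
      + apply Rmult_le_compat_l; [left; apply exp_pos | apply Hexp; assumption].
      + rewrite (Rmult_comm (exp _)), Rmult_assoc, <- exp_plus.
        apply Rmult_le_compat_l; [exact HK |]. apply exp_le.
        pose proof (Hcos theta Ht). assert (0 <= eps * (r * r)) by nra. nra.
    - rewrite <- (Rmult_1_l r) at 4. apply gaussian_le_exp; nra. }
  assert (Dray : forall theta, 0 <= theta <= beta -> decaying (rotated fe theta) Ke).
  { intros theta Ht. split; intros y Hy.
    - destruct (De y theta Hy Ht) as [l Hl].
      apply continuous_Cmult; [apply continuous_const | apply continuous_on_ray with l, Hl].
    - unfold rotated. rewrite Cmod_mult, Cmod_cis, Rmult_1_l. apply Be; assumption. }
  destruct (decaying_halfline _ _ (Dray 0 ltac:(lra))) as [v Hv].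
  destruct (decaying_halfline _ _ (Dray beta ltac:(lra))) as [v' Hv'].
  assert (Hv0 : halfline (fun y : R => fe y) v).
  { eapply halfline_ext; [| exact Hv]. intros y _. unfold rotated.
    assert (E : cexp (0%R, 0%R) = RtoC 1) by exact cexp_0.
    rewrite E, Cmult_1_l, Cmult_1_r. reflexivity. }
  assert (v = v') as <- by exact (halfline_rotation fe beta Ke v v' Hbeta De Be Hv0 Hv').
  exists v. split; [exact Hv0 |].
  apply (halfline_Cmod_le (fun y => rotated fe beta y - rotated f beta y)%C).
  2: { eapply halfline_minus; [apply Dray; lra | apply decaying_rotated | exact Hv' | exact Hw]. }
  split.
  { apply (decaying_minus _ _ _ _ (Dray beta ltac:(lra)) decaying_rotated). }
  intros y Hy.
  set (u := (- RtoC eps * ((y * cexp (0%R, beta)) * (y * cexp (0%R, beta))))%C).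
  replace (rotated fe beta y - rotated f beta y)%C
    with ((cexp u - 1) * rotated f beta y)%C by (unfold rotated, fe, u; ring).
  rewrite Cmod_mult.
  (* With y^2 <= 4 e^y, decay at rate 2 from [Cmod_rotated_le] leaves e^{-y}; hence the factor 4 and
     the D + 2 in the statement. *)
  assert (U1 : Cmod (cexp u - 1) <= eps * (4 * exp y)).
  { eapply Rle_trans; [apply Cmod_cexp_sub_1 |].
    assert (E : fst u <= 0).
    { assert (E : fst u = - eps * (y * y * cos (2 * beta))).
      { rewrite <- fst_polar_sq. unfold u. rewrite <- RtoC_opp. apply re_scal_l. }
      rewrite E. pose proof (Hcos beta ltac:(lra)). assert (0 <= eps * (y * y)) by nra. nra. }
    rewrite Rmax_left, exp_0, Rmult_1_r by exact E.
    unfold u. rewrite !Cmod_mult, Cmod_opp, !Cmod_R, Cmod_cis, !Rabs_pos_eq by lra.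
    pose proof (exp_sq_lower y Hy). nra. }
  assert (U2 := Cmod_rotated_le 2 y Hy). fold L in U2.
  apply Rle_trans with (eps * (4 * exp y) * (L * exp (- (2 * y)))).
  - apply Rmult_le_compat; try apply Cmod_ge_0; assumption.
  - right. replace (- (2 * y)) with (- y + - y) by ring. rewrite exp_plus.
    rewrite exp_Ropp. field. pose proof (exp_pos y). lra.
Qed.
End Regularization.

(** J is the integral over the rotated ray, in which eps does not occur; the regularized integrals
    converge to it at a linear rate. The last hypothesis makes the decay constants locally uniform
    in k, as [halfline_cderiv] requires. *)
Lemma halfline_family (O : C -> Prop) (f : C -> C -> C) (beta c s : R) (K D : C -> R) :
  0 <= beta -> 0 < c -> 0 < s ->
  (forall theta, 0 <= theta <= beta -> c <= cos (2 * theta)) ->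
  (forall k, O k -> 0 <= K k) ->
  (forall k r theta, O k -> 0 <= r -> 0 <= theta <= beta ->
     exists l, cderiv (f k) (r * cexp (0%R, theta))%C l) ->
  (forall k r theta, O k -> 0 <= r -> 0 <= theta <= beta ->
     Cmod (f k (r * cexp (0%R, theta))%C) <= K k * exp (D k * r)) ->
  (forall k r, O k -> 0 <= r ->
     Cmod (f k (r * cexp (0%R, beta))%C) <= K k * exp (D k * r - s * (r * r))) ->
  (forall k r, O k -> 0 <= r ->
     exists l, cderiv (fun k => f k (r * cexp (0%R, beta))%C) k l) ->
  (forall k, O k -> exists rho K1 D1, 0 < rho /\
     forall k', Cmod (k' - k) < rho -> O k' /\ K k' <= K1 /\ D k' <= D1) ->
  exists J : C -> C,
    (forall k, O k -> exists (I : R -> C) (L : R), 0 <= L /\ forall eps, 0 < eps ->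
       halfline (fun y : R => cexp (- RtoC eps * (RtoC y * RtoC y)) * f k y)%C (I eps) /\
       Cmod (I eps - J k) <= L * eps) /\
    (forall k, O k -> exists l, cderiv J k l).
Proof.
  intros Hb Hc Hs Hcos HK Hz Hexp Hgauss Hk Hloc.
  (* The default value 0 outside O makes J a total function. *)
  assert (Ex : forall k, exists v, O k -> halfline (rotated (f k) beta) v).
  { intros k. destruct (classic (O k)) as [Ok | N]; [| exists (RtoC 0); tauto].
    destruct (decaying_halfline _ _ (decaying_rotated (f k) beta s (K k) (D k) Hb Hs (HK k Ok)
      (fun r theta => Hz k r theta Ok) (fun r => Hgauss k r Ok))) as [v Hv].
    exists v. intros _. exact Hv. }
  set (J := fun k => proj1_sig (constructive_indefinite_description _ (Ex k))).
  assert (HJ : forall k, O k -> halfline (rotated (f k) beta) (J k)).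
  { intros k. exact (proj2_sig (constructive_indefinite_description _ (Ex k))). }
  exists J. split.
  - intros k Ok.
    set (L := 4 * (K k * exp ((D k + 2) * (D k + 2) / (4 * s)))).
    assert (Ei : forall eps, exists v, 0 < eps ->
      halfline (fun y : R => cexp (- RtoC eps * (RtoC y * RtoC y)) * f k y)%C v /\
      Cmod (v - J k) <= L * eps).
    { intros eps. destruct (Rlt_dec 0 eps) as [He | N]; [| exists (RtoC 0); tauto].
      destruct (gaussian_regularization (f k) beta c s (K k) (D k) Hb Hc Hs (HK k Ok) Hcos
        (fun r theta => Hz k r theta Ok) (fun r theta => Hexp k r theta Ok)
        (fun r => Hgauss k r Ok) (J k) eps (HJ k Ok) He) as [v Hv].
      exists v. intros _. exact Hv. }
    exists (fun eps => proj1_sig (constructive_indefinite_description _ (Ei eps))), L.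
    split.
    + pose proof (HK k Ok). pose proof (exp_pos ((D k + 2) * (D k + 2) / (4 * s))).
      unfold L. nra.
    + intros eps. exact (proj2_sig (constructive_indefinite_description _ (Ei eps))).
  - intros k0 Ok0. destruct (Hloc k0 Ok0) as [rho [K1 [D1 [Hrho HB]]]].
    assert (HK1 : 0 <= K1).
    { destruct (HB k0) as [_ [H _]].
      - replace (k0 - k0)%C with (RtoC 0) by ring. rewrite Cmod_0. exact Hrho.
      - pose proof (HK k0 Ok0). lra. }
    (* The radius is rho / 3 because [halfline_cderiv] works on the disc of three times its
       radius. *)
    apply (halfline_cderiv (fun k => rotated (f k) beta) J k0 (rho / 3)
      (K1 * exp ((D1 + 1) * (D1 + 1) / (4 * s)))); [lra | | |].
    + intros k y Hkk Hy. destruct (HB k ltac:(lra)) as [Ok _].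
      destruct (Hk k y Ok Hy) as [l Hl]. eexists.
      unfold rotated. apply cderiv_scal, Hl.
    + intros k Hkk. destruct (HB k ltac:(lra)) as [Ok [B1 B2]].
      apply (decaying_rotated (f k) beta s K1 D1 Hb Hs HK1 (fun r theta => Hz k r theta Ok)).
      intros r Hr. eapply Rle_trans; [apply Hgauss; assumption |].
      apply Rmult_le_compat; [apply HK, Ok | left; apply exp_pos | exact B1 |].
      apply exp_le. nra.
    + intros k Hkk. apply HJ, HB. lra.
Qed.

(** * The quadratic phase on rays of the double sector, and the theorem *)

Lemma Cmod_chirp (a x : R) (z : C) :
  Cmod (cexp (Ci * (a * ((z - x) * (z - x))))) = exp (- (2 * a * (fst z - x) * snd z)).
Proof. rewrite Cmod_cexp. f_equal. simpl. ring. Qed.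

(** The sign -1 adds pi to the angle and so leads to the second half of the double sector. *)
Lemma in_double_sector (alpha sg r theta : R) :
  (sg = 1 \/ sg = -1) -> 0 <= r -> 0 <= theta <= alpha ->
  in_sector alpha (sg * (r * cexp (0%R, theta)))%C.
Proof.
  intros Hsg [Hr | <-] Ht; [right | left; ring].
  destruct Hsg as [-> | ->].
  - exists r, theta. split; [exact Hr |]. split; [left; exact Ht |].
    unfold cexp, Cmult, RtoC; simpl. rewrite exp_0. f_equal; ring.
  - exists r, (theta + PI). split; [exact Hr |]. split; [right; lra |].
    rewrite neg_cos, neg_sin.
    unfold cexp, Cmult, RtoC; simpl. rewrite exp_0. f_equal; ring.
Qed.

(** The quadratic part of the exponent contains sg^2 = 1, so both half-lines gain the same Gaussian
    when turned in the same sense; the centre x contributes only a linear term. *)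
Lemma Cmod_chirp_ray_le (a x sg r theta : R) :
  0 <= a -> (sg = 1 \/ sg = -1) -> 0 <= r ->
  Cmod (cexp (Ci * (a * ((sg * (r * cexp (0%R, theta)) - x) *
                          (sg * (r * cexp (0%R, theta)) - x)))))
  <= exp (2 * a * Rabs x * r - a * sin (2 * theta) * (r * r)).
Proof.
  intros Ha Hsg Hr. rewrite Cmod_chirp. apply exp_le.
  replace (snd (sg * (r * cexp (0%R, theta)))%C) with (sg * (r * sin theta))
    by (unfold cexp, Cmult, RtoC; simpl; rewrite exp_0; ring).
  replace (fst (sg * (r * cexp (0%R, theta)))%C) with (sg * (r * cos theta))
    by (unfold cexp, Cmult, RtoC; simpl; rewrite exp_0; ring).
  rewrite sin_2a.
  assert (Hsg2 : sg * sg = 1) by (destruct Hsg as [-> | ->]; ring).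
  assert (X : sg * (x * sin theta) <= Rabs x).
  { eapply Rle_trans; [apply Rle_abs |]. rewrite !Rabs_mult.
    assert (Rabs sg = 1) as -> by (destruct Hsg as [-> | ->];
      [apply Rabs_pos_eq; lra | rewrite Rabs_left; lra]).
    assert (Rabs (sin theta) <= 1) by (apply Rabs_le, SIN_bound).
    pose proof (Rabs_pos x). nra. }
  replace (- (2 * a * (sg * (r * cos theta) - x) * (sg * (r * sin theta))))
    with (2 * a * r * (sg * (x * sin theta)) - a * (2 * sin theta * cos theta) *
      ((sg * sg) * (r * r)))
    by ring.
  rewrite Hsg2, Rmult_1_l.
  assert (0 <= 2 * a * r) by nra. nra.
Qed.

Theorem theorem4p7 (T : Rbar) (V : R -> R -> C) (alpha : R) (Omega : C -> Prop)
    (G : R -> R -> C -> C) (O : C -> Prop) (phi : C -> C -> C) (A B : C -> R) :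
  StandingG T V alpha Omega G ->
  open O ->
  (forall kappa, O kappa -> holo_on Omega (phi kappa)) ->
  (forall kappa z, O kappa -> Omega z ->
     Cmod (phi kappa z) <= A kappa * exp (B kappa * Cmod z)) ->
  (forall kappa, O kappa -> 0 <= A kappa /\ 0 <= B kappa) ->
  (forall kappa, O kappa -> continuous A kappa /\ continuous B kappa) ->
  (forall z, Omega z -> holo_on O (fun kappa => phi kappa z)) ->
  forall t x, in_oT T t ->
    exists Psi : C -> C,
      (forall kappa, O kappa -> Psi_val G (phi kappa) t x (Psi kappa)) /\
      holo_on O Psi.
Proof.
  intros HG HO Hphi Hbound HAB Hcont Hk t x Ht.
  destruct HG as (_ & Halpha & _ & Hsec & HGz & _ & a & Gt & A0 & B0 & A1 & B1 &
    _ & Ha & _ & HGt & HGtb & HA0 & _).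
  specialize (Ha t Ht). destruct (HA0 t x Ht) as [HA0t HB0t]. clear HA0.
  (* The bound alpha keeps the rays in the double sector; pi/8 makes 2 beta at most pi/4, so that
     cos(2 beta) and sin(2 beta) are both positive. *)
  set (beta := Rmin alpha (PI / 8)).
  pose proof PI_RGT_0 as Hpi.
  assert (Hb0 : 0 < beta) by (apply Rmin_pos; lra).
  assert (Hba : beta <= alpha) by apply Rmin_l.
  assert (Hb8 : beta <= PI / 8) by apply Rmin_r.
  assert (Hc : 0 < cos (2 * beta)) by (apply cos_gt_0; lra).
  assert (Hs : 0 < a t * sin (2 * beta))
    by (apply Rmult_lt_0_compat; [exact Ha | apply sin_gt_0; lra]).
  (* The three growth rates add up: the linear part of the phase, the amplitude of the kernel, and
     phi. *)
  set (D := fun k => 2 * a t * Rabs x + B0 t x + B k).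
  set (K := fun k => A0 t x * A k).
  (* The sign sg = -1 reflects the negative half-line onto the positive one, so one argument serves
     both. *)
  set (f := fun (sg : R) k z => (G t x (sg * z)%C * phi k (sg * z)%C)%C).
  assert (Om : forall sg r theta, (sg = 1 \/ sg = -1) -> 0 <= r -> 0 <= theta <= beta ->
    Omega (sg * (r * cexp (0%R, theta)))%C).
  { intros sg r theta Hsg Hr Hth. apply Hsec, in_double_sector; try assumption. lra. }
  assert (Hf : forall (sg : R) k z, O k -> Omega (sg * z)%C -> exists l, cderiv (f sg k) z l).
  { intros sg k z Ok Oz.
    destruct (HGz t x Ht _ Oz) as [l1 H1]. destruct (Hphi k Ok _ Oz) as [l2 H2].
    apply is_derive_cderiv in H1, H2.
    pose proof (cderiv_scal sg _ z _ (cderiv_id z)) as Hl.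
    eexists. apply cderiv_mult.
    - exact (cderiv_comp (G t x) (fun w => sg * w)%C z l1 _ H1 Hl).
    - exact (cderiv_comp (phi k) (fun w => sg * w)%C z l2 _ H2 Hl). }
  assert (Hfb : forall sg k r theta, (sg = 1 \/ sg = -1) -> O k -> 0 <= r ->
    0 <= theta <= beta ->
    Cmod (f sg k (r * cexp (0%R, theta))%C) <=
      K k * exp (D k * r - a t * sin (2 * theta) * (r * r))).
  { intros sg k r theta Hsg Ok Hr Hth. unfold f.
    pose proof (Om sg r theta Hsg Hr Hth) as Oz.
    assert (Mz : Cmod (sg * (r * cexp (0%R, theta))) = r).
    { rewrite !Cmod_mult, !Cmod_R, Cmod_cis, (Rabs_pos_eq r Hr).
      destruct Hsg as [-> | ->]; [rewrite Rabs_pos_eq; lra | rewrite Rabs_left; lra]. }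
    rewrite (HGt t x _ Ht Oz), !Cmod_mult.
    pose proof (Cmod_chirp_ray_le (a t) x sg r theta (Rlt_le _ _ Ha) Hsg Hr) as E1.
    pose proof (HGtb t x _ Ht Oz) as E2. pose proof (Hbound k _ Ok Oz) as E3.
    rewrite Mz in E2, E3.
    replace (K k * exp (D k * r - a t * sin (2 * theta) * (r * r)))
      with (exp (2 * a t * Rabs x * r - a t * sin (2 * theta) * (r * r)) *
        (A0 t x * exp (B0 t x * r)) * (A k * exp (B k * r))).
    2: { unfold K, D.
         replace ((2 * a t * Rabs x + B0 t x + B k) * r - a t * sin (2 * theta) * (r * r))
           with ((2 * a t * Rabs x * r - a t * sin (2 * theta) * (r * r)) +
             (B0 t x * r + B k * r)) by ring.
         rewrite !exp_plus. ring. }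
    apply Rmult_le_compat; [| apply Cmod_ge_0 | | exact E3].
    - apply Rmult_le_pos; apply Cmod_ge_0.
    - apply Rmult_le_compat; try apply Cmod_ge_0; assumption. }
  assert (HK : forall k, O k -> 0 <= K k).
  { intros k Ok. apply Rmult_le_pos; [exact HA0t | apply HAB, Ok]. }
  (* Openness of O and continuity of A and B give a disc on which both exceed their central values
     by less than 1. *)
  assert (Hloc : forall k, O k -> exists rho K1 D1, 0 < rho /\
    forall k', Cmod (k' - k) < rho -> O k' /\ K k' <= K1 /\ D k' <= D1).
  { intros k Ok. destruct (Hcont k Ok) as [CA CB].
    pose proof (proj1 (filterlim_locally A (A k)) CA (mkposreal 1 Rlt_0_1)) as LA.
    pose proof (proj1 (filterlim_locally B (B k)) CB (mkposreal 1 Rlt_0_1)) as LB.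
    destruct (filter_and _ _ (HO k Ok) (filter_and _ _ LA LB)) as [rho Hrho].
    exists rho, (A0 t x * (A k + 1)), (2 * a t * Rabs x + B0 t x + (B k + 1)).
    split; [apply cond_pos |]. intros k' Hk'.
    destruct (Hrho k' (C_ball_of_Cmod _ _ _ Hk')) as [Ok' [L1 L2]].
    change (Rabs (A k' - A k) < 1) in L1. change (Rabs (B k' - B k) < 1) in L2.
    apply Rabs_def2 in L1, L2. split; [exact Ok' |]. split.
    - apply Rmult_le_compat_l; [exact HA0t | lra].
    - unfold D. lra. }
  assert (Half : forall sg, sg = 1 \/ sg = -1 -> exists J : C -> C,
    (forall k, O k -> exists (I : R -> C) (L : R), 0 <= L /\ forall eps, 0 < eps ->
       halfline (fun y : R => cexp (- RtoC eps * (RtoC y * RtoC y)) * f sg k y)%C (I eps) /\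
       Cmod (I eps - J k) <= L * eps) /\
    (forall k, O k -> exists l, cderiv J k l)).
  { intros sg Hsg.
    apply (halfline_family O (f sg) beta (cos (2 * beta)) (a t * sin (2 * beta)) K D);
      try assumption; try lra.
    - intros theta Hth. apply cos_decr_1; lra.
    - intros k r theta Ok Hr Hth. apply Hf; [exact Ok | apply Om; assumption].
    (* Inside the sector sin(2 theta) >= 0, and the Gaussian factor is dropped; it is kept only on
       the last ray. *)
    - intros k r theta Ok Hr Hth. eapply Rle_trans; [apply Hfb; assumption |].
      apply Rmult_le_compat_l; [apply HK, Ok |]. apply exp_le.
      assert (0 <= sin (2 * theta)) by (apply sin_ge_0; lra).
      assert (0 <= a t * sin (2 * theta)) by nra. nra.
    - intros k r Ok Hr. apply Hfb; try assumption. lra.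
    - intros k r Ok Hr.
      destruct (Hk _ (Om sg r beta Hsg Hr ltac:(lra)) k Ok) as [l Hl].
      apply is_derive_cderiv in Hl. eexists. apply cderiv_scal, Hl. }
  destruct (Half 1 (or_introl eq_refl)) as [J1 [HI1 HJ1]].
  destruct (Half (-1) (or_intror eq_refl)) as [J2 [HI2 HJ2]].
  exists (fun k => J1 k + J2 k)%C. split.
  - intros k Ok.
    destruct (HI1 k Ok) as [I1 [L1 [HL1 P1]]]. destruct (HI2 k Ok) as [I2 [L2 [HL2 P2]]].
    exists (fun eps => I1 eps + I2 eps)%C. split.
    + intros eps He. destruct (P1 eps He) as [Q1 _]. destruct (P2 eps He) as [Q2 _].
      assert (E : forall y : R,
        RtoC (exp (- eps * y ^ 2)) = cexp (- RtoC eps * (RtoC y * RtoC y))%C).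
      { intros y. unfold cexp; simpl.
        replace (- eps * (y * y - 0 * 0) - - 0 * (y * 0 + 0 * y)) with (- eps * (y * (y * 1)))
          by ring.
        replace (- eps * (y * 0 + 0 * y) + - 0 * (y * y - 0 * 0)) with 0 by ring.
        rewrite cos_0, sin_0. unfold RtoC. f_equal; ring. }
      apply is_RInt_gen_of_halflines.
      * intros y.
        (* Real points lie on the edges of the double sector: angle 0 for y >= 0, and its reflection
           for y < 0. *)
        assert (Oy : Omega (RtoC 1 * RtoC y)%C).
        { destruct (Rle_lt_dec 0 y) as [L | L].
          - pose proof (Om 1 y 0 (or_introl eq_refl) L ltac:(lra)) as Z.
            replace (cexp (0, 0)) with (RtoC 1) in Z by (symmetry; exact cexp_0).
            rewrite Cmult_1_r in Z. exact Z.
          - pose proof (Om (-1) (- y) 0 (or_intror eq_refl) ltac:(lra) ltac:(lra)) as Z.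
            replace (cexp (0, 0)) with (RtoC 1) in Z by (symmetry; exact cexp_0).
            rewrite Cmult_1_r, <- RtoC_mult in Z.
            replace (-1 * - y) with (1 * y) in Z by ring. rewrite RtoC_mult in Z. exact Z. }
        destruct (Hf 1 k y Ok Oy) as [l Hl]. destruct (cderiv_gaussian eps y) as [m Hm].
        (* Writing y as y * 1 presents the real line as a ray of direction 1, the form
           [continuous_on_ray] expects. *)
        apply (continuous_ext (T := R_UniformSpace) (U := C_UniformSpace)
          (fun y : R => (cexp (- RtoC eps * ((y * 1) * (y * 1))) * f 1 k (y * 1))%C)).
        { intros u. rewrite E, !Cmult_1_r. unfold f. rewrite !Cmult_1_l. reflexivity. }
        rewrite <- (Cmult_1_r y) in Hl, Hm.
        apply continuous_Cmult.
        -- exact (continuous_on_ray (fun w => cexp (- RtoC eps * (w * w))%C) 1 m y Hm).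
        -- exact (continuous_on_ray (f 1 k) 1 l y Hl).
      * eapply halfline_ext; [| exact Q1]. intros y _. cbv beta.
        rewrite E. unfold f. rewrite !Cmult_1_l. reflexivity.
      * eapply halfline_ext; [| exact Q2]. intros y _. cbv beta.
        rewrite E. unfold f.
        replace (RtoC (-1) * RtoC y)%C with (RtoC (- y))
          by (rewrite <- RtoC_mult; f_equal; ring).
        rewrite !RtoC_opp. do 2 f_equal. ring.
    + apply filterlim_locally. intros eps.
      (* The linear rates of the two half-lines add; the summand 1 avoids division by 0. *)
      assert (Hq : 0 < eps / (L1 + L2 + 1))
        by (apply Rdiv_lt_0_compat; [apply cond_pos | lra]).
      exists (mkposreal _ Hq). intros e He He0. simpl in He0.
      change (Rabs (e - 0) < eps / (L1 + L2 + 1)) in He.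
      rewrite Rminus_0_r, Rabs_pos_eq in He by lra.
      apply C_ball_of_Cmod.
      replace (I1 e + I2 e - (J1 k + J2 k))%C with ((I1 e - J1 k) + (I2 e - J2 k))%C by ring.
      eapply Rle_lt_trans; [apply Cmod_triangle |].
      destruct (P1 e He0) as [_ R1]. destruct (P2 e He0) as [_ R2].
      assert (e * (L1 + L2 + 1) < eps).
      { replace (pos eps) with (eps / (L1 + L2 + 1) * (L1 + L2 + 1)) by (field; lra).
        apply Rmult_lt_compat_r; lra. }
      nra.
  - intros k Ok. destruct (HJ1 k Ok) as [l1 H1]. destruct (HJ2 k Ok) as [l2 H2].
    exists (l1 + l2)%C. apply is_derive_cderiv, cderiv_plus; assumption.
Qed.
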